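(* Let $M$ and $\alpha$ be positive real parameters, $\Delta=r^2-2Mr-\alpha^2$, $\Xi=r^2-\alpha^2\cos^2\theta$, and consider the Euclidean Kerr space with the Euclidean (Riemannian, i.e. Wick-rotated) Kerr metric $$g_K=\Xi\left(\frac{dr^2}{\Delta}+d\theta^2\right)+\frac{\sin^2\theta}{\Xi}\left(\alpha\,dt+(r^2-\alpha^2)\,d\phi\right)^2+\frac{\Delta}{\Xi}\left(dt-\alpha\sin^2\theta\,d\phi\right)^2 .$$ Let $$e^1=\sqrt{\tfrac{\Xi}{\Delta}}\,dr,\quad e^2=\sqrt{\Xi}\,d\theta,\quad e^3=\tfrac{\sin\theta}{\sqrt{\Xi}}\left(\alpha\,dt+(r^2-\alpha^2)\,d\phi\right),\quad e^4=\sqrt{\tfrac{\Delta}{\Xi}}\left(dt-\alpha\sin^2\theta\,d\phi\right)$$ be the orthonormal coframe, with orientation $e^1\wedge e^2\wedge e^3\wedge e^4$, let $(e_1,e_2,e_3,e_4)$ be the dual frame, and let $J$ be the almost complex structure with $Je_1=e_4$, $Je_2=e_3$, $Je_3=-e_2$, $Je_4=-e_1$, whose associated 2-form is the self-dual form $\omega=e^1\wedge e^4+e^2\wedge e^3$, that is, $$\omega=dr\wedge dt-\alpha\sin^2\theta\,dr\wedge d\phi-\alpha\sin\theta\,dt\wedge d\theta+(r^2-\alpha^2)\sin\theta\,d\theta\wedge d\phi .$$ Then: (1) $d\omega=2(r+\alpha\cos\theta)\sin\theta\,dr\wedge d\theta\wedge d\phi$, which is not identically zero, so $g_K$ is not Kähler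 (with respect to $J$); (2) the Lee form associated with $\omega$ is $$\xi=\frac{2(dr+\alpha\sin\theta\,d\theta)}{r-\alpha\cos\theta}=d\left(\log\left[C(r-\alpha\cos\theta)^2\right]\right),$$ where $C$ is an arbitrary constant; it is exact and satisfies $d\omega=\xi\wedge\omega$, and hence the Euclidean Kerr metric $g_K$ is globally conformally Kähler; (3) taking $C=1$, the corresponding conformal factor is $\lambda=\exp\left(-\log\left[(r-\alpha\cos\theta)^2\right]\right)=1/(r-\alpha\cos\theta)^2$, and the conformally scaled metric $g_{conf}=g_K/(r-\alpha\cos\theta)^2$ is Kähler: the almost complex structure $J$ (which has the same coordinate components for the rescaled frame) is integrable, i.e. its Nijenhuis tensor vanishes, and the Kähler form $$\hat\omega=\frac{1}{(r-\alpha\cos\theta)^2}\left(dr\wedge dt-\alpha\sin^2\theta\,dr\wedge d\phi-\alpha\sin\theta\,dt\wedge d\theta+(r^2-\alpha^2)\sin\theta\,d\theta\wedge d\phi\right)$$ is closed.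
   Context: The metric $g_K$ is obtained from the Lorentzian Kerr metric in Boyer-Lindquist coordinates $(t,r,\theta,\phi)$ by the Wick rotation $t\to it$, $\alpha\to i\alpha$; $M$ is the mass and $\alpha$ the angular momentum per unit mass. A Riemannian metric $g$ is Hermitian for a complex structure $J$ if $g(JX,JY)=g(X,Y)$; its Kähler form is $\omega(X,Y)=g(JX,Y)$, and $g$ is Kähler if moreover $d\omega=0$. An almost complex structure $J$ is integrable if and only if its Nijenhuis tensor $N(X,Y)=[X,Y]+J[JX,Y]+J[X,JY]-[JX,JY]$ vanishes. A Hermitian manifold $(M^{2n},J,g)$ is locally conformally Kähler if and only if there is a globally defined closed 1-form $\xi$ (the Lee form) with $d\omega=\xi\wedge\omega$; it is given by $\xi=-\frac{1}{n-1}(\delta\omega)\circ J$, with $\delta$ the codifferential. If $\xi$ is exact, $(M^{2n},J,g)$ is globally conformally Kähler; if $\xi=df$, then $d(e^{-f}\omega)=0$ and $e^{-f}g$ is a Kähler metric. *)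

(* Defs.v *)
From HB Require Import structures.
From mathcomp Require Import all_boot all_order all_algebra.
From mathcomp Require Import all_classical all_reals all_analysis.
Set Implicit Arguments.
Unset Strict Implicit.
Unset Printing Implicit Defensive.
Import Order.TTheory GRing.Theory Num.Theory.
Import numFieldNormedType.Exports.
Local Open Scope classical_set_scope.
Local Open Scope ring_scope.

(** * Tensor calculus on a coordinate domain of R^n

    Points and tangent vectors are both row vectors; the tangent space at any
    point is identified with 'rV_n through the coordinate frame, so a constant
    vector denotes a constant-coefficient vector field. *)

(** C^k on an open set [U], by iterated directional derivatives. *)
Fixpoint Ck {R : realType} {n : nat} {W : normedModType R} (k : nat)
    (U : set 'rV[R]_n.+1) (f : 'rV[R]_n.+1 -> W) : Prop :=
  (forall p, U p -> {for p, continuous f}) /\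
  if k is k'.+1 then
    (forall p v, U p -> derivable f p v) /\
    (forall v, Ck k' U (fun p => 'D_v f p))
  else True.

Definition smooth {R : realType} {n : nat} {W : normedModType R}
    (U : set 'rV[R]_n.+1) (f : 'rV[R]_n.+1 -> W) : Prop :=
  forall k, Ck k U f.

(** A differential k-form, evaluated at a point on the k rows of a matrix.
    A 1-form thus takes a tangent vector directly. *)
Definition dform (R : realType) (n k : nat) : Type :=
  'rV[R]_n -> 'M[R]_(k, n) -> R.

Definition smooth_form {R : realType} {n k : nat} (U : set 'rV[R]_n.+1)
    (eta : dform R n.+1 k) : Prop :=
  forall N, smooth U (fun p => eta p N).

Definition dform0 {R : realType} {n : nat} (f : 'rV[R]_n -> R) : dform R n 0 :=
  fun p _ => f p.

Definition dx {R : realType} {n : nat} (i : 'I_n) : dform R n 1 :=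
  fun _ v => v 0 i.

(** Exterior derivative; no bracket terms occur because the rows of [N] stand
    for constant (hence commuting) vector fields. *)
Definition extd {R : realType} {n k : nat} (eta : dform R n.+1 k) :
    dform R n.+1 k.+1 :=
  fun p N => \sum_(i < k.+1)
    (-1) ^+ i * 'D_(row i N) (fun q => eta q (row' i N)) p.

(** Wedge product of a 1-form with a k-form, normalised so that
    (a /\ b)(X, Y) = a(X) b(Y) - a(Y) b(X). *)
Definition wedge {R : realType} {n k : nat} (a : dform R n 1)
    (eta : dform R n k) : dform R n k.+1 :=
  fun p N => \sum_(i < k.+1) (-1) ^+ i * a p (row i N) * eta p (row' i N).

Definition closed_form {R : realType} {n k : nat} (U : set 'rV[R]_n.+1)
    (eta : dform R n.+1 k) : Prop :=
  smooth_form U eta /\ forall p N, U p -> extd eta p N = 0.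

Definition exact_1form {R : realType} {n : nat} (U : set 'rV[R]_n.+1)
    (xi : dform R n.+1 1) : Prop :=
  exists f : 'rV[R]_n.+1 -> R,
    smooth U f /\ forall p v, U p -> xi p v = extd (dform0 f) p v.

(** ** Metrics and (almost) complex structures *)

Definition riemannian {R : realType} {n : nat} (U : set 'rV[R]_n.+1)
    (g : 'rV[R]_n.+1 -> 'rV[R]_n.+1 -> 'rV[R]_n.+1 -> R) : Prop :=
  (forall u v, smooth U (fun p => g p u v)) /\
  forall p, U p ->
    [/\ forall u, scalar (g p u),
        forall u v, g p u v = g p v u
      & forall u, u != 0 -> 0 < g p u u].

Definition almost_complex {R : realType} {n : nat} (U : set 'rV[R]_n.+1)
    (J : 'rV[R]_n.+1 -> 'rV[R]_n.+1 -> 'rV[R]_n.+1) : Prop :=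
  (forall v, smooth U (fun p => J p v)) /\
  forall p, U p -> linear (J p) /\ forall v, J p (J p v) = - v.

Definition lie_bracket {R : realType} {n : nat}
    (X Y : 'rV[R]_n.+1 -> 'rV[R]_n.+1) : 'rV[R]_n.+1 -> 'rV[R]_n.+1 :=
  fun p => 'D_(X p) Y p - 'D_(Y p) X p.

Definition nijenhuis {R : realType} {n : nat}
    (J : 'rV[R]_n.+1 -> 'rV[R]_n.+1 -> 'rV[R]_n.+1)
    (X Y : 'rV[R]_n.+1 -> 'rV[R]_n.+1) : 'rV[R]_n.+1 -> 'rV[R]_n.+1 :=
  let JX := fun p => J p (X p) in
  let JY := fun p => J p (Y p) in
  fun p => lie_bracket X Y p + J p (lie_bracket JX Y p)
           + J p (lie_bracket X JY p) - lie_bracket JX JY p.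

Definition integrable_acs {R : realType} {n : nat} (U : set 'rV[R]_n.+1)
    (J : 'rV[R]_n.+1 -> 'rV[R]_n.+1 -> 'rV[R]_n.+1) : Prop :=
  forall X Y, smooth U X -> smooth U Y ->
  forall p, U p -> nijenhuis J X Y p = 0.

Definition hermitian_metric {R : realType} {n : nat} (U : set 'rV[R]_n.+1)
    (g : 'rV[R]_n.+1 -> 'rV[R]_n.+1 -> 'rV[R]_n.+1 -> R)
    (J : 'rV[R]_n.+1 -> 'rV[R]_n.+1 -> 'rV[R]_n.+1) : Prop :=
  [/\ riemannian U g, almost_complex U J, integrable_acs U J
    & forall p u v, U p -> g p (J p u) (J p v) = g p u v].

Definition kahler_form {R : realType} {n : nat}
    (g : 'rV[R]_n.+1 -> 'rV[R]_n.+1 -> 'rV[R]_n.+1 -> R)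
    (J : 'rV[R]_n.+1 -> 'rV[R]_n.+1 -> 'rV[R]_n.+1) : dform R n.+1 2 :=
  fun p N => g p (J p (row 0 N)) (row 1 N).

Definition kahler {R : realType} {n : nat} (U : set 'rV[R]_n.+1)
    (g : 'rV[R]_n.+1 -> 'rV[R]_n.+1 -> 'rV[R]_n.+1 -> R)
    (J : 'rV[R]_n.+1 -> 'rV[R]_n.+1 -> 'rV[R]_n.+1) : Prop :=
  hermitian_metric U g J /\ closed_form U (kahler_form g J).

Definition lck_form {R : realType} {n : nat} (U : set 'rV[R]_n.+1)
    (g : 'rV[R]_n.+1 -> 'rV[R]_n.+1 -> 'rV[R]_n.+1 -> R)
    (J : 'rV[R]_n.+1 -> 'rV[R]_n.+1 -> 'rV[R]_n.+1)
    (xi : dform R n.+1 1) : Prop :=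
  closed_form U xi /\
  forall p N, U p ->
    extd (kahler_form g J) p N = wedge xi (kahler_form g J) p N.

Definition globally_conformally_kahler {R : realType} {n : nat}
    (U : set 'rV[R]_n.+1)
    (g : 'rV[R]_n.+1 -> 'rV[R]_n.+1 -> 'rV[R]_n.+1 -> R)
    (J : 'rV[R]_n.+1 -> 'rV[R]_n.+1 -> 'rV[R]_n.+1) : Prop :=
  hermitian_metric U g J /\
  exists xi, lck_form U g J xi /\ exact_1form U xi.

(** ** Coframes, Hodge star and codifferential *)

Definition orthonormal_coframe {R : realType} {n : nat}
    (U : set 'rV[R]_n) (g : 'rV[R]_n -> 'rV[R]_n -> 'rV[R]_n -> R)
    (e : 'I_n -> dform R n 1) : Prop :=
  forall p u v, U p -> g p u v = \sum_i e i p u * e i p v.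

(** [v *m coframe_mx e p] is the row of the values [e j p v]. *)
Definition coframe_mx {R : realType} {n : nat} (e : 'I_n -> dform R n 1)
    (p : 'rV[R]_n) : 'M[R]_n :=
  \matrix_(i, j) e j p (delta_mx 0 i).

Definition dual_frame {R : realType} {n : nat} (e : 'I_n -> dform R n 1)
    (i : 'I_n) (p : 'rV[R]_n) : 'rV[R]_n :=
  row i (invmx (coframe_mx e p)).

(** The volume form e^1 /\ ... /\ e^n. *)
Definition volume {R : realType} {n : nat} (e : 'I_n -> dform R n 1) :
    dform R n n :=
  fun p N => \det (\matrix_(i, j) e j p (row i N)).

(** Hodge star for the metric and the orientation making [e] a positively
    oriented orthonormal coframe, with dual frame (E_i):
      ( * eta)(N) = 1/k! \sum_f eta(E_f1, ..., E_fk) vol(E_f1, ..., E_fk, N),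
    so that * (e^1 /\ ... /\ e^k) = e^(k+1) /\ ... /\ e^n. *)
Definition hodge {R : realType} (k l : nat)
    (e : 'I_(k + l) -> dform R (k + l) 1) (eta : dform R (k + l) k) :
    dform R (k + l) l :=
  fun p N => (k`!%:R)^-1 *
    \sum_(f : {ffun 'I_k -> 'I_(k + l)})
      let E := \matrix_(i < k) dual_frame e (f i) p in
      eta p E * volume e p (col_mx E N).

(** Codifferential of a 2-form in dimension 4: delta = - * d * in every even
    dimension. *)
Definition codiff2 {R : realType} (e : 'I_4 -> dform R 4 1)
    (eta : dform R 4 2) : dform R 4 1 :=
  fun p v => - @hodge R 3 1 e (extd (@hodge R 2 2 e eta : dform R 4 2)) p v.

(** xi = - 1/(n-1) (delta omega) o J in real dimension 2n = 4. *)
Definition lee_form {R : realType} (e : 'I_4 -> dform R 4 1)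
    (J : 'rV[R]_4 -> 'rV[R]_4 -> 'rV[R]_4) (omega : dform R 4 2) :
    dform R 4 1 :=
  fun p v => - (2 - 1)^-1 * codiff2 e omega p (J p v).

(** * The Euclidean Kerr metric

    Coordinates (t, r, theta, phi). *)

Definition i_t : 'I_4 := @Ordinal 4 0 isT.
Definition i_r : 'I_4 := @Ordinal 4 1 isT.
Definition i_th : 'I_4 := @Ordinal 4 2 isT.
Definition i_ph : 'I_4 := @Ordinal 4 3 isT.

Definition rcoord {R : realType} (p : 'rV[R]_4) : R := p 0 i_r.
Definition thcoord {R : realType} (p : 'rV[R]_4) : R := p 0 i_th.
Definition dt {R : realType} : dform R 4 1 := dx i_t.
Definition dr {R : realType} : dform R 4 1 := dx i_r.
Definition dth {R : realType} : dform R 4 1 := dx i_th.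
Definition dph {R : realType} : dform R 4 1 := dx i_ph.

(** The region outside the bolt r = r_+ (the larger root of Delta) and off
    the axis, where the coordinates and the coframe are regular.  The periodic
    coordinates t and phi range over the universal cover; none of the tensors
    below depends on them. *)
Definition kerr_domain {R : realType} (M a : R) : set 'rV[R]_4 :=
  [set p | M + Num.sqrt (M ^+ 2 + a ^+ 2) < rcoord p /\ 0 < thcoord p < pi].

Definition Delta {R : realType} (M a : R) (p : 'rV[R]_4) : R :=
  rcoord p ^+ 2 - 2 * M * rcoord p - a ^+ 2.

Definition Xi {R : realType} (a : R) (p : 'rV[R]_4) : R :=
  rcoord p ^+ 2 - a ^+ 2 * cos (thcoord p) ^+ 2.

Definition sigma3 {R : realType} (a : R) : dform R 4 1 :=
  fun p v => a * dt p v + (rcoord p ^+ 2 - a ^+ 2) * dph p v.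

Definition sigma4 {R : realType} (a : R) : dform R 4 1 :=
  fun p v => dt p v - a * sin (thcoord p) ^+ 2 * dph p v.

Definition kerr_metric {R : realType} (M a : R) (p u v : 'rV[R]_4) : R :=
  Xi a p * (dr p u * dr p v / Delta M a p + dth p u * dth p v)
  + sin (thcoord p) ^+ 2 / Xi a p * (sigma3 a p u * sigma3 a p v)
  + Delta M a p / Xi a p * (sigma4 a p u * sigma4 a p v).

(** Frame indices, in the order fixing the orientation. *)
Definition j1 : 'I_4 := @Ordinal 4 0 isT.
Definition j2 : 'I_4 := @Ordinal 4 1 isT.
Definition j3 : 'I_4 := @Ordinal 4 2 isT.
Definition j4 : 'I_4 := @Ordinal 4 3 isT.

Definition kerr_coframe {R : realType} (M a : R) (i : 'I_4) : dform R 4 1 :=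
  match val i with
  | 0%N => fun p v => Num.sqrt (Xi a p / Delta M a p) * dr p v
  | 1%N => fun p v => Num.sqrt (Xi a p) * dth p v
  | 2%N => fun p v => sin (thcoord p) / Num.sqrt (Xi a p) * sigma3 a p v
  | _   => fun p v => Num.sqrt (Delta M a p / Xi a p) * sigma4 a p v
  end.

(** The endomorphism field with J e_1 = e_4, J e_2 = e_3, J e_3 = - e_2,
    J e_4 = - e_1 in the frame dual to [e]. *)
Definition frame_J {R : realType} (e : 'I_4 -> dform R 4 1)
    (p v : 'rV[R]_4) : 'rV[R]_4 :=
  e j1 p v *: dual_frame e j4 p + e j2 p v *: dual_frame e j3 p
  - e j3 p v *: dual_frame e j2 p - e j4 p v *: dual_frame e j1 p.

Definition kerr_J {R : realType} (M a : R) : 'rV[R]_4 -> 'rV[R]_4 -> 'rV[R]_4 :=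
  frame_J (kerr_coframe M a).

Definition kerr_omega {R : realType} (a : R) : dform R 4 2 :=
  fun p N => wedge dr dt p N
    - a * sin (thcoord p) ^+ 2 * wedge dr dph p N
    - a * sin (thcoord p) * wedge dt dth p N
    + (rcoord p ^+ 2 - a ^+ 2) * sin (thcoord p) * wedge dth dph p N.

Definition kerr_xi {R : realType} (a : R) : dform R 4 1 :=
  fun p v => 2 * (dr p v + a * sin (thcoord p) * dth p v)
             / (rcoord p - a * cos (thcoord p)).

Definition kerr_conf {R : realType} (M a : R) (p u v : 'rV[R]_4) : R :=
  kerr_metric M a p u v / (rcoord p - a * cos (thcoord p)) ^+ 2.

(** The coframe orthonormal for the rescaled metric. *)
Definition conf_coframe {R : realType} (M a : R) (i : 'I_4) : dform R 4 1 :=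
  fun p v => kerr_coframe M a i p v / (rcoord p - a * cos (thcoord p)).

(* Main.v *)
Require Import Defs.
From HB Require Import structures.
From mathcomp Require Import all_boot all_order all_algebra.
From mathcomp Require Import all_classical all_reals all_analysis.
From mathcomp Require Import ring lra.
Set Implicit Arguments.
Unset Strict Implicit.
Unset Printing Implicit Defensive.
Import Order.TTheory GRing.Theory Num.Theory.
Import numFieldNormedType.Exports.
Local Open Scope classical_set_scope.
Local Open Scope ring_scope.

(** The coframe e^i is orthonormal and J rotates its dual frame, so the metric
    identities, J^2 = -1 and the self-duality of omega = e^14 + e^23 are frame
    algebra.  Although the coframe contains square roots, both omega and the
    coordinate matrix of J are rational in r, sin theta and cos theta; this makes
    d omega and the Nijenhuis tensor, which only involves the derivatives of J,
    explicit rational expressions.  In an oriented orthonormal frame adapted to J,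
    any xi with d omega = xi /\ omega is the Lee form, because
    -(delta omega) o J = *(xi /\ omega) o J = xi.  Finally xi = 2 d log L with
    L = r - a cos theta, whence
    d (omega / L^2) = (d omega - xi /\ omega) / L^2 = 0. *)

(** * Directional derivatives and C^k functions *)

(** The square roots disappear from J because each term of J is a product of one coframe form and
    one frame vector whose roots match: e^1 with e_4, e^4 with e_1, e^2 with e_3, e^3 with e_2 all
    give rational products. The Lee equation rests on the factorisation Xi = (r - a cos theta)(r + a
    cos theta). In xi /\ omega the two dr /\ dt /\ dth terms cancel, and the rest is 2 Xi sin theta
    / L times dr /\ dth /\ dph, which is 2 (r + a cos theta) sin theta times that form. Both factors
    are positive outside the bolt, so L also serves as a global conformal factor. Two constraints
    shape the computations. Smoothness is phrased with iterated directional derivatives, so the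
    calculus works along lines instead of with total derivatives. And [field] sees sin theta and cos
    theta as unrelated atoms, so the Pythagorean identity has to be inserted by hand at the right
    place. *)

Section line_derivatives.
Context {R : realType} {V : normedModType R}.
Implicit Types (f g : V -> R) (p v : V).

(** Only the derivative of [f] along [v] is given, not differentiability at [p]. Hence the
    one-variable chain rule is applied to the restriction of [f] to the line through [p] in
    direction [v]. *)
Lemma is_derive_comp (h : R -> R) (dh : R) f df p v :
  is_derive (f p) 1 h dh -> is_derive p v f df ->
  is_derive p v (fun q => h (f q)) (dh * df).
Proof.
move=> [hd hv] [fd fv].
pose l := fun t : R => f (t *: v + p).
have l0 : l 0 = f p by rewrite /l scale0r add0r.
have lineE (F : V -> R) : 'D_v F p = 'D_1 (fun t : R => F (t *: v + p)) 0.
  rewrite /derive; set g1 := fun h => h^-1 *: _; set g2 := fun h => h^-1 *: _.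
  suff -> : g1 = g2 by [].
  by apply/funext => t; rewrite /g1 /g2 /= addr0 scale0r add0r [_%:A]mulr1.
have ld : derivable l 0 1 by exact: (derivable1P _ _ _).1.
have hld : derivable h (l 0) 1 by rewrite l0.
apply: DeriveDef.
  apply: (derivable1P _ _ _).2; apply/derivable1_diffP.
  by apply: (@differentiable_comp _ _ _ _ l h); apply/derivable1_diffP.
rewrite lineE -derive1E (derive1_comp ld hld) !derive1E l0 hv; congr (_ * _).
by rewrite -[LHS](lineE f) fv.
Qed.

Lemma is_deriveDf f g df dg p v : is_derive p v f df -> is_derive p v g dg ->
  is_derive p v (fun q => f q + g q) (df + dg).
Proof. exact: is_deriveD. Qed.

Lemma is_deriveNf f df p v : is_derive p v f df ->
  is_derive p v (fun q => - f q) (- df).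
Proof. exact: is_deriveN. Qed.

Lemma is_deriveMf f g df dg p v : is_derive p v f df -> is_derive p v g dg ->
  is_derive p v (fun q => f q * g q) (df * g p + f p * dg).
Proof.
move=> hf hg; apply: is_derive_eq (is_deriveM hf hg) _.
by rewrite /GRing.scale/= addrC [g p * _]mulrC.
Qed.

Lemma is_deriveXf f df n p v : is_derive p v f df ->
  is_derive p v (fun q => f q ^+ n.+1) (n.+1%:R * f p ^+ n * df).
Proof.
move=> hf; rewrite [X in is_derive _ _ X _](_ : _ = f ^+ n.+1).
  exact: is_deriveX.
by apply/funext => q; rewrite exprfctE.
Qed.

Lemma is_deriveVf f df p v : f p != 0 -> is_derive p v f df ->
  is_derive p v (fun q => (f q)^-1) (- (f p) ^- 2 * df).
Proof.
move=> fp [fd <-]; apply: DeriveDef; first exact: derivableV.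
by rewrite deriveV.
Qed.

Lemma is_derive_coord (n : nat) (i : 'I_n.+1) (p v : 'rV[R]_n.+1) :
  is_derive p v (fun q : 'rV[R]_n.+1 => q 0 i) (v 0 i).
Proof.
have dv : derivable (id : 'rV[R]_n.+1 -> 'rV[R]_n.+1) p v by exact: derivable_id.
apply: DeriveDef; first by move/derivable_mxP : dv => /(_ 0 i).
have := derive_mx dv; rewrite derive_id => /matrixP/(_ 0 i).
by rewrite mxE => ->.
Qed.

End line_derivatives.

Lemma continuous_mx {R : realType} {T : topologicalType} m l
    (F : T -> 'M[R]_(m.+1, l.+1)) (p : T) :
  (forall i j, {for p, continuous (fun q => F q i j)}) ->
  {for p, continuous F}.
Proof.
move=> cF; apply/cvgrPdist_le => /= e e0; near=> x.
rewrite /Num.Def.normr/= mx_normrE (bigmax_le _ (ltW e0))//= => i _.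
rewrite !mxE/=.
move: i; near: x; apply: filter_forall => /= i.
by have /cvgrPdist_le := cF i.1 i.2; exact.
Unshelve. all: by end_near. Qed.

(** * Closure properties of C^k and smooth functions on an open set *)

Section Ck_calculus.
Context {R : realType} {n : nat} (U : set 'rV[R]_n.+1).
Hypothesis openU : open U.

Lemma near_open (P : 'rV[R]_n.+1 -> Prop) (p : 'rV[R]_n.+1) :
  U p -> (forall q, U q -> P q) -> \near p, P p.
Proof. by move=> Up PU; exact: filterS PU (open_nbhs_nbhs (conj openU Up)). Qed.

(** Since [U] is open, an identity on [U] holds near each of its points and so passes to all
    iterated derivatives. The later lemmas use this to replace a derivative by its formula, which is
    valid on [U] only. *)
Lemma Ck_ext {W : normedModType R} k (f g : 'rV[R]_n.+1 -> W) :
  (forall p, U p -> f p = g p) -> Ck k U f -> Ck k U g.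
Proof.
have cont_ext (f' g' : 'rV[R]_n.+1 -> W) p : U p ->
    (forall q, U q -> f' q = g' q) ->
    {for p, continuous f'} -> {for p, continuous g'}.
  move=> Up fg; have gf : \near p, f' p = g' p by exact: near_open.
  rewrite /prop_for /continuous_at -(fg p Up) => cf.
  exact: cvg_trans (near_eq_cvg gf) cf.
elim: k f g => [|k IH] f g fg /= [cf df].
  by split=> // p Up; apply: cont_ext (cf p Up).
split=> [p Up|]; first exact: cont_ext (cf p Up).
case: df => df1 df2; split=> [p v Up|v].
  by apply: near_eq_derivable (df1 p v Up); exact: near_open.
apply: IH (df2 v) => p Up; apply: near_eq_derive; exact: near_open.
Qed.

Lemma CkW {W : normedModType R} k (f : 'rV[R]_n.+1 -> W) :
  Ck k.+1 U f -> Ck k U f.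
Proof.
elim: k f => [|k IH] f [cf [df1 df2]]; first by split.
by split=> //; split=> // v; exact: IH.
Qed.

Lemma Ck_cst {W : normedModType R} k (w : W) : Ck k U (fun=> w).
Proof.
elim: k w => [|k IH] w; first by split => // p _; exact: cst_continuous.
split=> [p _|]; first exact: cst_continuous.
split=> [p v _|v]; first exact: derivable_cst.
rewrite [X in Ck _ _ X](_ : _ = (fun=> 0)); first exact: IH.
by apply/funext => p; rewrite derive_cst.
Qed.

Lemma Ck_add k (f g : 'rV[R]_n.+1 -> R) :
  Ck k U f -> Ck k U g -> Ck k U (fun p => f p + g p).
Proof.
elim: k f g => [|k IH] f g [cf df] [cg dg].
  split=> // p Up; exact: continuousD (cf p Up) (cg p Up).
split=> [p Up|]; first by exact: continuousD (cf p Up) (cg p Up).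
case: df dg => df1 df2 [dg1 dg2]; split=> [p v Up|v].
  exact: derivableD (df1 _ _ Up) (dg1 _ _ Up).
apply: Ck_ext (IH _ _ (df2 v) (dg2 v)) => p Up.
by rewrite (deriveD (df1 p v Up) (dg1 p v Up)).
Qed.

Lemma Ck_mul k (f g : 'rV[R]_n.+1 -> R) :
  Ck k U f -> Ck k U g -> Ck k U (fun p => f p * g p).
Proof.
elim: k f g => [|k IH] f g Hf Hg.
  case: Hf Hg => cf _ [cg _]; split=> // p Up; exact: continuousM (cf p Up) (cg p Up).
case: (Hf) (Hg) => cf [df1 df2] [cg [dg1 dg2]].
split=> [p Up|]; first by exact: continuousM (cf p Up) (cg p Up).
split=> [p v Up|v]; first exact: derivableM (df1 _ _ Up) (dg1 _ _ Up).
(* The Leibniz formula contains [f] and [g] themselves, which are needed at order [k] only; [CkW]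
   lowers them. *)
apply: Ck_ext (Ck_add (IH _ _ (CkW Hf) (dg2 v)) (IH _ _ (CkW Hg) (df2 v))).
by move=> p Up; rewrite (deriveM (df1 p v Up) (dg1 p v Up)).
Qed.

(** By the chain rule a derivative of [h] after [f] is [dh] after [f] times a derivative of [f].
    Smoothness of sin, cos, inverse and ln follows by induction on the order, because their
    derivatives are expressed by functions already controlled at the previous order. *)
Lemma Ck_comp_step k (h dh : R -> R) (f : 'rV[R]_n.+1 -> R) :
  (forall p, U p -> is_derive (f p) 1 h (dh (f p))) ->
  Ck k.+1 U f -> Ck k U (fun p => dh (f p)) -> Ck k.+1 U (fun p => h (f p)).
Proof.
move=> hdh [cf [df1 df2]] Hdh; split=> [p Up|].
  apply: (@continuous_comp _ _ _ f h); first exact: cf.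
  apply/differentiable_continuous/derivable1_diffP.
  by case: (hdh _ Up).
have D p v (Up : U p) := is_derive_comp (hdh _ Up) (derivableP (df1 p v Up)).
split=> [p v Up|v]; first by case: (D p v Up).
apply: Ck_ext (Ck_mul Hdh (df2 v)) => p Up.
by case: (D p v Up).
Qed.

Lemma Ck_comp0 (h : R -> R) (f : 'rV[R]_n.+1 -> R) :
  (forall p, U p -> derivable h (f p) 1) ->
  Ck 0 U f -> Ck 0 U (fun p => h (f p)).
Proof.
move=> hd [cf _]; split=> // p Up.
apply: (@continuous_comp _ _ _ f h); first exact: cf.
exact/differentiable_continuous/derivable1_diffP/hd.
Qed.

Lemma Ck_mx k m l (F : 'rV[R]_n.+1 -> 'M[R]_(m.+1, l.+1)) :
  (forall i j, Ck k U (fun p => F p i j)) -> Ck k U F.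
Proof.
elim: k F => [|k IH] F HF.
  by split=> // p Up; apply: continuous_mx => i j; case: (HF i j) => + _; exact.
split=> [p Up|].
  by apply: continuous_mx => i j; case: (HF i j) => + _; exact.
have dF p v : U p -> derivable F p v.
  by move=> Up; apply/derivable_mxP => i j; case: (HF i j) => _ [+ _]; exact.
split=> // v.
apply: (@Ck_ext _ _ (fun p => \matrix_(i, j) 'D_v (fun q => F q i j) p)).
  by move=> p Up; rewrite derive_mx//; exact: dF.
apply: IH => i j; case: (HF i j) => _ [_ /(_ v)].
by apply: Ck_ext => p Up; rewrite mxE.
Qed.

Lemma smooth_ext {W : normedModType R} (f g : 'rV[R]_n.+1 -> W) :
  (forall p, U p -> f p = g p) -> smooth U f -> smooth U g.
Proof. by move=> fg sf k; exact: Ck_ext fg (sf k). Qed.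

Lemma smooth_cst {W : normedModType R} (w : W) : smooth U (fun=> w).
Proof. by move=> k; exact: Ck_cst. Qed.

Lemma smooth_add (f g : 'rV[R]_n.+1 -> R) :
  smooth U f -> smooth U g -> smooth U (fun p => f p + g p).
Proof. by move=> sf sg k; exact: Ck_add. Qed.

Lemma smooth_mul (f g : 'rV[R]_n.+1 -> R) :
  smooth U f -> smooth U g -> smooth U (fun p => f p * g p).
Proof. by move=> sf sg k; exact: Ck_mul. Qed.

Lemma smooth_opp (f : 'rV[R]_n.+1 -> R) :
  smooth U f -> smooth U (fun p => - f p).
Proof.
move=> sf; apply: smooth_ext (smooth_mul (smooth_cst (-1 : R)) sf) => p _.
by rewrite mulN1r.
Qed.

Lemma smooth_exp (f : 'rV[R]_n.+1 -> R) m :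
  smooth U f -> smooth U (fun p => f p ^+ m).
Proof.
move=> sf; elim: m => [|m IH]; first exact: (smooth_cst (1 : R)).
by apply: smooth_ext (smooth_mul sf IH) => p _; rewrite exprS.
Qed.

Lemma smooth_coord (i : 'I_n.+1) : smooth U (fun p => p 0 i).
Proof.
have c : forall p, U p -> {for p, continuous (fun p : 'rV[R]_n.+1 => p 0 i)}.
  by move=> p _; exact: coord_continuous.
have D (p v : 'rV[R]_n.+1) := is_derive_coord i p v.
case=> [|k]; split=> //; split=> [p v _|v]; first by case: (D p v).
by apply: (@Ck_ext _ _ (fun=> v 0 i)) (Ck_cst _ _) => p _; case: (D p v).
Qed.

Lemma smooth_sin_cos (f : 'rV[R]_n.+1 -> R) : smooth U f ->
  smooth U (fun p => sin (f p)) /\ smooth U (fun p => cos (f p)).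
Proof.
(* Each function is the derivative of the other up to sign, so the induction must carry both. *)
move=> sf; suff H k : Ck k U (fun p => sin (f p)) /\ Ck k U (fun p => cos (f p)).
  by split=> k; case: (H k).
elim: k => [|k [IHs IHc]].
  by split; apply: Ck_comp0.
split; first by apply: (Ck_comp_step (dh := cos)).
apply: (Ck_comp_step (dh := fun x => - sin x)) => //.
apply: Ck_ext (Ck_mul (Ck_cst k (-1 : R)) IHs) => p _; by rewrite mulN1r.
Qed.

Lemma smooth_inv (f : 'rV[R]_n.+1 -> R) :
  (forall p, U p -> f p != 0) -> smooth U f -> smooth U (fun p => (f p)^-1).
Proof.
move=> f0 sf.
(* The derivative is written as a product of inverses so that the induction hypothesis applies to
   each factor. *)
have D p : U p -> is_derive (f p) 1 (@GRing.inv R) (- (f p)^-1 * (f p)^-1).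
  move=> Up; apply: is_derive_eq (is_deriveVf (f0 _ Up) (is_derive_id _ _)) _.
  by rewrite mulr1 mulNr expr2 invfM.
elim=> [|k IH]; first by apply: Ck_comp0 => // p /D[].
apply: (Ck_comp_step (dh := fun x => - x^-1 * x^-1)) => //.
apply: Ck_ext (Ck_mul (Ck_mul (Ck_cst k (-1 : R)) IH) IH) => p _; by rewrite mulN1r.
Qed.

Lemma smooth_ln (f : 'rV[R]_n.+1 -> R) :
  (forall p, U p -> 0 < f p) -> smooth U f -> smooth U (fun p => ln (f p)).
Proof.
move=> f0 sf.
have D p : U p -> is_derive (f p) 1 (@ln R) (f p)^-1.
  by move=> Up; apply: is_derive1_ln; exact: f0.
case=> [|k]; first by apply: Ck_comp0 => // p /D[].
apply: (Ck_comp_step (dh := fun x => x^-1)) => //.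
by apply: smooth_inv => // p /f0/lt0r_neq0.
Qed.

Lemma smooth_mx m l (F : 'rV[R]_n.+1 -> 'M[R]_(m.+1, l.+1)) :
  (forall i j, smooth U (fun p => F p i j)) -> smooth U F.
Proof. by move=> sF k; apply: Ck_mx => i j; exact: sF. Qed.

End Ck_calculus.

(** * Hodge star and Lee form in dimension four *)

Section four_dimensional_algebra.
Context {R : realType}.

Lemma ord4P (P : 'I_4 -> Prop) : P j1 -> P j2 -> P j3 -> P j4 -> forall i, P i.
Proof.
move=> P1 P2 P3 P4 [[|[|[|[|//]]]] Hi].
- by rewrite (_ : Ordinal Hi = j1)//; exact: val_inj.
- by rewrite (_ : Ordinal Hi = j2)//; exact: val_inj.
- by rewrite (_ : Ordinal Hi = j3)//; exact: val_inj.
- by rewrite (_ : Ordinal Hi = j4)//; exact: val_inj.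
Qed.

Lemma big_ord4 (F : 'I_4 -> R) : \sum_(i < 4) F i = F j1 + F j2 + F j3 + F j4.
Proof.
rewrite !big_ord_recr big_ord0 /= add0r.
by congr (F _ + F _ + F _ + F _); apply: val_inj.
Qed.

(** Entries indexed by [nat] let repeated minors reduce by computing [bump], without [lift] terms on
    ordinals. *)
Definition minor0 (F : nat -> nat -> R) (j : nat) : nat -> nat -> R :=
  fun i k => F i.+1 (bump j k).

Lemma det_matrixS n (F : nat -> nat -> R) :
  \det (\matrix_(i < n.+1, j < n.+1) F i j) =
  \sum_(j < n.+1) (-1) ^+ j * F 0%N j *
    \det (\matrix_(i < n, k < n) minor0 F j i k).
Proof.
rewrite (expand_det_row _ ord0); apply: eq_bigr => j _.
rewrite mxE /cofactor add0n mulrCA mulrA; congr (_ * \det _).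
by apply/matrixP => i k; rewrite !mxE.
Qed.

Lemma det4 (A : 'M[R]_4) :
  let m (i j : 'I_4) := A j3 i * A j4 j - A j3 j * A j4 i in
  let n (i j k : 'I_4) := A j2 i * m j k - A j2 j * m i k + A j2 k * m i j in
  \det A = A j1 j1 * n j2 j3 j4 - A j1 j2 * n j1 j3 j4
           + A j1 j3 * n j1 j2 j4 - A j1 j4 * n j1 j2 j3.
Proof.
pose F (i j : nat) : R := A (inord i) (inord j).
have AF (i j : 'I_4) : A i j = F i j by rewrite /F !inord_val.
rewrite /= !AF (_ : A = \matrix_(i < 4, j < 4) F i j) /=; last first.
  by apply/matrixP => i j; rewrite mxE AF.
rewrite det_matrixS !big_ord_recl big_ord0.
rewrite !det_matrixS !big_ord_recl !big_ord0.
rewrite !det_matrixS !big_ord_recl !big_ord0.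
rewrite !det_matrixS !big_ord_recl !big_ord0.
rewrite !det_mx00 /minor0 /= /bump /= !addn0 !add1n /=.
by ring.
Qed.

Lemma j_eqE : ((j1 == j1 = true) * (j1 == j2 = false) * (j1 == j3 = false)
  * (j1 == j4 = false) * (j2 == j1 = false) * (j2 == j2 = true)
  * (j2 == j3 = false) * (j2 == j4 = false) * (j3 == j1 = false)
  * (j3 == j2 = false) * (j3 == j3 = true) * (j3 == j4 = false)
  * (j4 == j1 = false) * (j4 == j2 = false) * (j4 == j3 = false)
  * (j4 == j4 = true))%type.
Proof. by []. Qed.

(** This is the volume form on E_i, E_j, E_k and a last vector with frame components [w]: the sign
    of the permutation times the component at the missing index, and 0 if an index repeats. *)
Lemma det_units (i j k : 'I_4) (w : 'I_4 -> R) :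
  \det (\matrix_(h < 4, l < 4) match val h with
       | 0%N => (l == i)%:R | 1%N => (l == j)%:R
       | 2 => (l == k)%:R | _ => w l end) =
  match val i, val j, val k with
  | 0, 1, 2 | 1, 2, 0 | 2, 0, 1 => w j4
  | 0, 2, 1 | 1, 0, 2 | 2, 1, 0 => (- w j4)%R
  | 0, 1, 3 | 1, 3, 0 | 3, 0, 1 => (- w j3)%R
  | 0, 3, 1 | 1, 0, 3 | 3, 1, 0 => w j3
  | 0, 2, 3 | 2, 3, 0 | 3, 0, 2 => w j2
  | 0, 3, 2 | 2, 0, 3 | 3, 2, 0 => (- w j2)%R
  | 1, 2, 3 | 2, 3, 1 | 3, 1, 2 => (- w j1)%R
  | 1, 3, 2 | 2, 1, 3 | 3, 2, 1 => w j1
  | _, _, _ => 0%R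
  end%N.
Proof.
rewrite det4 !mxE /=.
by elim/ord4P: i; elim/ord4P: j; elim/ord4P: k; rewrite !j_eqE /=; ring.
Qed.

Lemma big_ffun2 (I : finType) (F : {ffun 'I_2 -> I} -> R) :
  \sum_f F f = \sum_i \sum_j F (finfun (tnth [tuple i; j])).
Proof.
rewrite pair_big /= (reindex (fun ij : I * I => finfun (tnth [tuple ij.1; ij.2]))) //=.
apply: onW_bij; exists (fun f : {ffun 'I_2 -> I} => (f ord0, f ord_max)).
  by case=> i j; rewrite !ffunE.
by move=> f; apply/ffunP => -[[|[|//]] Hx]; rewrite ffunE; congr (f _); apply: val_inj.
Qed.

Lemma big_ffun3 (I : finType) (F : {ffun 'I_3 -> I} -> R) :
  \sum_f F f = \sum_i \sum_j \sum_k F (finfun (tnth [tuple i; j; k])).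
Proof.
transitivity (\sum_(x : I * (I * I)) F (finfun (tnth [tuple x.1; x.2.1; x.2.2]))).
  apply: reindex; apply: onW_bij.
  exists (fun f : {ffun 'I_3 -> I} => (f ord0, (f (lift ord0 ord0), f ord_max))).
    by case=> i [j k]; rewrite !ffunE.
  by move=> f; apply/ffunP => -[[|[|[|//]]] Hx]; rewrite ffunE;
    congr (f _); apply: val_inj.
rewrite -(pair_bigA _ (fun i jk => F (finfun (tnth [tuple i; jk.1; jk.2])))).
apply: eq_bigr => i _.
by rewrite -(pair_bigA _ (fun j k => F (finfun (tnth [tuple i; j; k])))).
Qed.

Lemma wedge1E (a b : dform R 4 1) (p : 'rV[R]_4) (N : 'M[R]_(2, 4)) :
  wedge a b p N = a p (row 0 N) * b p (row 1 N) - a p (row 1 N) * b p (row 0 N).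
Proof.
rewrite /wedge !big_ord_recl big_ord0 /= expr0 expr1 mul1r addr0 mulN1r mulNr.
have rE (i j : 'I_2) : i != j -> row' i N = row j N.
  move=> ij; apply/rowP => k; rewrite !mxE; congr (N _ _).
  by case: i j ij => [[|[|//]] ?] [[|[|//]] ?] // _; apply: val_inj.
rewrite (rE _ 1)// (rE _ 0)// (_ : lift ord0 ord0 = 1)//; exact: val_inj.
Qed.

End four_dimensional_algebra.

(** * Hodge star of a self-dual 2-form and uniqueness of the Lee form *)

Section self_dual_form.
Context {R : realType}.
Variables (U : set 'rV[R]_4) (e : 'I_4 -> dform R 4 1) (omega : dform R 4 2).
Hypothesis openU : open U.
Hypothesis dualE : forall p i j, U p -> e i p (dual_frame e j p) = (i == j)%:R.
Hypothesis omegaE : forall p N, U p ->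
  omega p N = wedge (e j1) (e j4) p N + wedge (e j2) (e j3) p N.

(** The permutation (1,4,2,3) is even, so the star exchanges e^1 /\ e^4 and e^2 /\ e^3. *)
Lemma hodge_self_dual p N : U p -> @hodge R 2 2 e omega p N = omega p N.
Proof.
move=> Up; rewrite /hodge big_ffun2 !big_ord4.
have volE i j : volume e p (col_mx
    (\matrix_(k < 2) dual_frame e (finfun (tnth [tuple i; j]) k) p) N)
    = \det (\matrix_(k < 4, l < 4) match val k with
       | 0%N => (l == i)%:R | 1%N => (l == j)%:R
       | 2 => e l p (row 0 N) | _ => e l p (row 1 N) end).
  congr (\det _); apply/matrixP => k l; rewrite !mxE.
  have rowE (h : 'I_2) (x y : 'I_4) :
     row h (\matrix_(k < 2) dual_frame e (finfun (tnth [tuple x; y]) k) p) =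
      dual_frame e (tnth [tuple x; y] h) p by rewrite rowK ffunE.
  elim/ord4P: k => /=.
  - rewrite -(dualE _ _ Up); congr (e _ _ _).
    rewrite (_ : j1 = lshift 2 ord0 :> 'I_(2 + 2)); last exact: val_inj.
    exact: etrans (rowKu ord0 _ _) (rowE ord0 i j).
  - rewrite -(dualE _ _ Up); congr (e _ _ _).
    rewrite (_ : j2 = lshift 2 ord_max :> 'I_(2 + 2)); last exact: val_inj.
    exact: etrans (rowKu ord_max _ _) (rowE ord_max i j).
  - congr (e _ _ _).
    rewrite (_ : j3 = rshift 2 0 :> 'I_(2 + 2)); last exact: val_inj.
    exact: rowKd.
  - congr (e _ _ _).
    rewrite (_ : j4 = rshift 2 1 :> 'I_(2 + 2)); last exact: val_inj.
    exact: rowKd.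
have omE i j : omega p
    (\matrix_(k < 2) dual_frame e (finfun (tnth [tuple i; j]) k) p)
    = (j1 == i)%:R * (j4 == j)%:R - (j1 == j)%:R * (j4 == i)%:R
    + ((j2 == i)%:R * (j3 == j)%:R - (j2 == j)%:R * (j3 == i)%:R).
  by rewrite omegaE// !wedge1E !rowK !ffunE /= !(dualE _ _ Up).
(* Of the sixteen index pairs only (1,4), (2,3) and their transposes survive; 1/2! absorbs the
   double count. *)
rewrite !omE !volE !j_eqE /= !(mul0r, mulr0, subr0, sub0r, add0r, addr0, mul1r, mulr1, mulN1r).
rewrite !det4 !mxE !j_eqE /= omegaE// !wedge1E.
have -> : 2`! = 2%N by [].
by field.
Qed.

Lemma wedge2E (a : dform R 4 1) (b : dform R 4 2) (p : 'rV[R]_4)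
    (N : 'M[R]_(3, 4)) :
  wedge a b p N = a p (row 0 N) * b p (row' 0 N)
    - a p (row 1 N) * b p (row' 1 N) + a p (row 2 N) * b p (row' 2 N).
Proof.
rewrite /wedge !big_ord_recl big_ord0 /= expr0 expr1 expr2 addr0 mulrNN !mul1r.
rewrite mulN1r mulNr addrA.
rewrite (_ : lift ord0 (lift ord0 ord0) = 2); last exact: val_inj.
by rewrite (_ : lift ord0 ord0 = 1)//; exact: val_inj.
Qed.

Lemma row_row' (m l : nat) (N : 'M[R]_(m.+1, l)) (i : 'I_m.+1) (j : 'I_m) :
  row j (row' i N : 'M[R]_(m, l)) = row (lift i j) N.
Proof. by apply/rowP => k; rewrite !mxE. Qed.

(** The right-hand side is -xi(J w) for the structure J of the frame, written without J. *)
Lemma hodge_wedge_self_dual (T : dform R 4 3) (xi : dform R 4 1) p w : U p ->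
  (forall N, T p N = wedge xi omega p N) ->
  @hodge R 3 1 e T p w =
    xi p (dual_frame e j1 p) * e j4 p w + xi p (dual_frame e j2 p) * e j3 p w
    - xi p (dual_frame e j3 p) * e j2 p w - xi p (dual_frame e j4 p) * e j1 p w.
Proof.
move=> Up TE; rewrite /hodge big_ffun3.
have volE i j k : volume e p (col_mx
    (\matrix_(h < 3) dual_frame e (finfun (tnth [tuple i; j; k]) h) p) w)
    = \det (\matrix_(h < 4, l < 4) match val h with
       | 0%N => (l == i)%:R | 1%N => (l == j)%:R
       | 2 => (l == k)%:R | _ => e l p w end).
  congr (\det _); apply/matrixP => h l; rewrite !mxE.
  pose E := \matrix_(h < 3) dual_frame e (finfun (tnth [tuple i; j; k]) h) p.
  have rowE (h' : 'I_3) : row h' E = dual_frame e (tnth [tuple i; j; k] h') p.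
    by rewrite rowK ffunE.
  elim/ord4P: h => /=.
  - rewrite -(dualE _ _ Up); congr (e _ _ _).
    rewrite (_ : j1 = lshift 1 0 :> 'I_(3 + 1)); last exact: val_inj.
    exact: etrans (rowKu 0 _ _) (rowE 0).
  - rewrite -(dualE _ _ Up); congr (e _ _ _).
    rewrite (_ : j2 = lshift 1 1 :> 'I_(3 + 1)); last exact: val_inj.
    exact: etrans (rowKu 1 _ _) (rowE 1).
  - rewrite -(dualE _ _ Up); congr (e _ _ _).
    rewrite (_ : j3 = lshift 1 2 :> 'I_(3 + 1)); last exact: val_inj.
    exact: etrans (rowKu 2 _ _) (rowE 2).
  - congr (e _ _ _).
    rewrite (_ : j4 = rshift 3 0 :> 'I_(3 + 1)); last exact: val_inj.
    apply: etrans (rowKd 0 _ _) _.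
    by apply/rowP => x; rewrite mxE.
(* [h i j] is omega(E_i, E_j). *)
pose h (i j : 'I_4) : R := match val i, val j with
  | 0, 3 | 1, 2 => 1%R | 3, 0 | 2, 1 => (-1)%R | _, _ => 0%R end%N.
have hE i j : (j1 == i)%:R * (j4 == j)%:R - (j1 == j)%:R * (j4 == i)%:R
    + ((j2 == i)%:R * (j3 == j)%:R - (j2 == j)%:R * (j3 == i)%:R) = h i j.
  by elim/ord4P: i; elim/ord4P: j; rewrite !j_eqE /h /=; ring.
pose x i := xi p (dual_frame e i p).
have TEE i j k : T p
    (\matrix_(l < 3) dual_frame e (finfun (tnth [tuple i; j; k]) l) p)
    = x i * h j k - x j * h i k + x k * h i j.
  rewrite TE wedge2E !omegaE// !wedge1E !row_row' !rowK !ffunE /=.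
  by rewrite !(dualE _ _ Up) !hE.
under eq_bigr => i _ do under eq_bigr => j _ do
  under eq_bigr => k _ do rewrite TEE volE det_units.
rewrite !big_ord4 /h /=.
have -> : 3`! = 6%N by [].
by rewrite -/(x j1) -/(x j2) -/(x j3) -/(x j4); field.
Qed.

Lemma extd_ext k (eta eta' : dform R 4 k) p N : U p ->
  (forall q N', U q -> eta q N' = eta' q N') ->
  extd eta p N = extd eta' p N.
Proof.
move=> Up ee; apply: eq_bigr => i _; congr (_ * _).
by apply: near_eq_derive; apply: (near_open openU Up) => q Uq; exact: ee.
Qed.

(* Applying J turns the Hodge dual of xi /\ omega back into xi. *)
Lemma lee_form_unique J (xi : dform R 4 1) p v : U p ->
  (forall N, extd omega p N = wedge xi omega p N) ->
  e j1 p (J p v) = - e j4 p v -> e j2 p (J p v) = - e j3 p v ->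
  e j3 p (J p v) = e j2 p v -> e j4 p (J p v) = e j1 p v ->
  xi p v = \sum_i xi p (dual_frame e i p) * e i p v ->
  lee_form e J omega p v = xi p v.
Proof.
move=> Up dxi J1 J2 J3 J4 xiE; rewrite /lee_form /codiff2.
rewrite (@hodge_wedge_self_dual _ xi)//; last first.
  (* Self-duality removes the inner star of the codifferential; it has to hold on all of [U], since
     it is differentiated. *)
  move=> N; rewrite -dxi; apply: extd_ext => // q N' Uq; exact: hodge_self_dual.
rewrite J1 J2 J3 J4 xiE big_ord4 (_ : 2 - 1 = 1 :> R) ?invr1; by ring.
Qed.

End self_dual_form.

(** * Almost complex structures *)

Section matrix_derivatives.
Context {R : realType} {V : normedModType R}.

Lemma is_derive_mx m n (F : V -> 'M[R]_(m.+1, n.+1))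
    (dF : 'M[R]_(m.+1, n.+1)) p v :
  (forall i j, is_derive p v (fun q => F q i j) (dF i j)) ->
  is_derive p v F dF.
Proof.
move=> H; have dv : derivable F p v.
  by apply/derivable_mxP => i j; case: (H i j).
apply: DeriveDef => //; rewrite derive_mx//.
by apply/matrixP => i j; rewrite mxE; case: (H i j).
Qed.

Lemma is_derive_mxE m n (F : V -> 'M[R]_(m.+1, n.+1))
    (dF : 'M[R]_(m.+1, n.+1)) p v i j :
  is_derive p v F dF -> is_derive p v (fun q => F q i j) (dF i j).
Proof.
move=> [H <-]; apply: DeriveDef; first by move/derivable_mxP : H.
by rewrite derive_mx// mxE.
Qed.

Lemma is_derive_mulmx m n l (A : V -> 'M[R]_(m.+1, n.+1))
    (B : V -> 'M[R]_(n.+1, l.+1))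
    (dA : 'M[R]_(m.+1, n.+1)) (dB : 'M[R]_(n.+1, l.+1)) p v :
  is_derive p v A dA -> is_derive p v B dB ->
  is_derive p v (fun q => A q *m B q) (dA *m B p + A p *m dB).
Proof.
move=> hA hB; apply: is_derive_mx => i j; rewrite !mxE -big_split /=.
rewrite [X in is_derive _ _ X _](_ : _ = \sum_k (fun q => A q i k * B q k j)).
  by apply: is_derive_sum => k; apply: is_deriveMf; exact: is_derive_mxE.
by apply/funext => q; rewrite mxE fct_sumE.
Qed.

End matrix_derivatives.

Section nijenhuis_tensor.
Context {R : realType} {n : nat}.
Variables (U : set 'rV[R]_n.+1) (J : 'rV[R]_n.+1 -> 'rV[R]_n.+1 -> 'rV[R]_n.+1).
Variables (A : 'rV[R]_n.+1 -> 'M[R]_n.+1).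
Variables (dA : 'rV[R]_n.+1 -> 'rV[R]_n.+1 -> 'M[R]_n.+1).
Hypothesis openU : open U.
Hypothesis JE : forall p v, U p -> J p v = v *m A p.
Hypothesis AA : forall p (v : 'rV[R]_n.+1), U p -> v *m A p *m A p = - v.
Hypothesis AE : forall p v, U p -> is_derive p v A (dA p v).

(* The Nijenhuis tensor is tensorial: the derivatives of the vector fields
   cancel and only those of J remain. *)
Lemma nijenhuis_tensorial X Y p : smooth U X -> smooth U Y -> U p ->
  nijenhuis J X Y p =
    (Y p *m dA p (X p) - X p *m dA p (Y p)) *m A p
    - (Y p *m dA p (X p *m A p) - X p *m dA p (Y p *m A p)).
Proof.
move=> sX sY Up.
have dd (Z : 'rV[R]_n.+1 -> 'rV[R]_n.+1) v : smooth U Z -> derivable Z p v.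
  by move=> /(_ 1%N)[_ [+ _]]; exact.
have DJ Z v : smooth U Z ->
    'D_v (fun q => J q (Z q)) p = 'D_v Z p *m A p + Z p *m dA p v.
  move=> sZ.
  have [_ <-] := is_derive_mulmx (derivableP (dd _ v sZ)) (AE v Up).
  by apply: near_eq_derive; apply: (near_open openU Up) => q Uq; exact: JE.
rewrite /nijenhuis /lie_bracket !DJ// !JE//.
rewrite !mulmxBl !mulmxDl !AA//.
set a := 'D_(X p) Y p; set b := 'D_(Y p) X p.
set c := 'D_(X p *m A p) Y p *m A p; set d := 'D_(Y p *m A p) X p *m A p.
set x := Y p *m _ *m A p; set y := X p *m _ *m A p.
set z := Y p *m _; set w := X p *m _.
by apply/rowP => i; rewrite !mxE; ring.
Qed.

End nijenhuis_tensor.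

(** * Pointwise algebra of J in a coframe and its dual frame *)

Section frame_almost_complex_structure.
Context {R : realType}.
Variables (e : 'I_4 -> dform R 4 1) (p : 'rV[R]_4).
Hypothesis lin_e : forall i v, e i p v = (v *m coframe_mx e p) 0 i.
Hypothesis unit_e : coframe_mx e p \in unitmx.

Local Notation E i := (dual_frame e i p).
Local Notation J := (frame_J e p).

Lemma dual_frame_coframe i j : e i p (E j) = (i == j)%:R.
Proof.
by rewrite lin_e -row_mul mulVmx// mxE mxE eq_sym.
Qed.

Lemma coframe_expansion v : v = \sum_i e i p v *: E i.
Proof.
rewrite -{1}(mulmxK unit_e v) mulmx_sum_row.
by apply: eq_bigr => i _; rewrite lin_e.
Qed.

Lemma coframeD i (u v : 'rV[R]_4) : e i p (u + v) = e i p u + e i p v.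
Proof. by rewrite !lin_e mulmxDl mxE. Qed.

Lemma coframeZ i a (u : 'rV[R]_4) : e i p (a *: u) = a * e i p u.
Proof. by rewrite !lin_e -scalemxAl mxE. Qed.

Lemma coframeN i (u : 'rV[R]_4) : e i p (- u) = - e i p u.
Proof. by rewrite -scaleN1r coframeZ mulN1r. Qed.

Lemma frame_J_coframe v :
  [/\ e j1 p (J v) = - e j4 p v, e j2 p (J v) = - e j3 p v,
      e j3 p (J v) = e j2 p v & e j4 p (J v) = e j1 p v].
Proof.
by rewrite /frame_J; split; rewrite !(coframeD, coframeN, coframeZ)
  !dual_frame_coframe !j_eqE /=; ring.
Qed.

Lemma frame_J_frame :
  [/\ J (E j1) = E j4, J (E j2) = E j3, J (E j3) = - E j2 & J (E j4) = - E j1].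
Proof.
by rewrite /frame_J; split; rewrite !dual_frame_coframe !j_eqE /=;
  apply/rowP => k; rewrite !mxE; ring.
Qed.

Lemma frame_JK v : J (J v) = - v.
Proof.
case: (frame_J_coframe v) => H1 H2 H3 H4.
rewrite [X in - X]coframe_expansion {1}/frame_J H1 H2 H3 H4.
by apply/rowP => i; rewrite [RHS]mxE summxE big_ord4 !mxE; ring.
Qed.

Lemma frame_J_isometry u v :
  \sum_i e i p (J u) * e i p (J v) = \sum_i e i p u * e i p v.
Proof.
case: (frame_J_coframe u) (frame_J_coframe v) => A1 A2 A3 A4 [B1 B2 B3 B4].
by rewrite !big_ord4 A1 A2 A3 A4 B1 B2 B3 B4; ring.
Qed.

Lemma frame_J_form (N : 'M[R]_(2, 4)) :
  \sum_i e i p (J (row 0 N)) * e i p (row 1 N)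
  = wedge (e j1) (e j4) p N + wedge (e j2) (e j3) p N.
Proof.
case: (frame_J_coframe (row 0 N)) => A1 A2 A3 A4.
by rewrite big_ord4 A1 A2 A3 A4 !wedge1E; ring.
Qed.

End frame_almost_complex_structure.

Section frame_J_rescaled.
Context {R : realType}.

(** Dividing the coframe by [c] multiplies the dual frame by [c], so every product of a form and a
    frame vector in J is unchanged. *)
Lemma frame_J_conformal (e e' : 'I_4 -> dform R 4 1) (p v : 'rV[R]_4) (c : R) :
  c != 0 -> coframe_mx e p \in unitmx ->
  (forall i u, e' i p u = e i p u / c) -> frame_J e' p v = frame_J e p v.
Proof.
move=> c0 ue e'E; rewrite /frame_J !e'E.
have cE : coframe_mx e' p = c^-1 *: coframe_mx e p.
  by apply/matrixP => i j; rewrite !mxE e'E mulrC.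
have dE i : dual_frame e' i p = c *: dual_frame e i p.
  by apply/rowP => k; rewrite /dual_frame cE invmxZ ?unitmxZ ?unitrV ?unitfE// invrK !mxE.
by rewrite !dE !scalerA !divfK.
Qed.

End frame_J_rescaled.

(** * The exterior derivative in degrees 0, 1 and 2 *)

Section low_degree_extd.
Context {R : realType}.

Lemma extd0E (f : 'rV[R]_4 -> R) (p v : 'rV[R]_4) :
  extd (dform0 f) p v = 'D_v f p.
Proof.
rewrite /extd /dform0 big_ord_recl big_ord0 expr0 mul1r addr0.
by congr ('D_ _ _ _); apply/rowP => k; rewrite mxE; congr (v _ _); apply: val_inj.
Qed.

Lemma extd1E (a : dform R 4 1) p (N : 'M[R]_(2, 4)) :
  extd a p N = 'D_(row 0 N) (fun q => a q (row 1 N)) p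
             - 'D_(row 1 N) (fun q => a q (row 0 N)) p.
Proof.
rewrite /extd !big_ord_recl big_ord0 /= expr0 expr1 mul1r addr0 mulN1r.
have rE (i j : 'I_2) : i != j -> row' i N = row j N.
  move=> ij; apply/rowP => k; rewrite !mxE; congr (N _ _).
  by case: i j ij => [[|[|//]] ?] [[|[|//]] ?] // _; apply: val_inj.
rewrite (_ : lift ord0 ord0 = 1); last exact: val_inj.
by rewrite (rE ord0 1)// (rE 1 0).
Qed.

Lemma extd2E (b : dform R 4 2) p (N : 'M[R]_(3, 4)) :
  extd b p N = 'D_(row 0 N) (fun q => b q (row' 0 N)) p
    - 'D_(row 1 N) (fun q => b q (row' 1 N)) p
    + 'D_(row 2 N) (fun q => b q (row' 2 N)) p.
Proof.
rewrite /extd !big_ord_recl big_ord0 /= expr0 expr1 expr2 addr0 mulrNN !mul1r.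
rewrite mulN1r addrA.
rewrite (_ : lift ord0 (lift ord0 ord0) = 2); last exact: val_inj.
by rewrite (_ : lift ord0 ord0 = 1)//; exact: val_inj.
Qed.

End low_degree_extd.

(** * The Euclidean Kerr metric *)

Section kerr.
Context {R : realType}.
Variables (M a : R).
Hypotheses (HM : 0 < M) (Ha : 0 < a).

Local Notation U := (kerr_domain M a).
Local Notation e := (kerr_coframe M a).
Local Notation Lam p := (rcoord p - a * cos (thcoord p)).
Local Notation s p := (sin (thcoord p)).
Local Notation c p := (cos (thcoord p)).
Local Notation r p := (rcoord p).
Local Notation D p := (Delta M a p).

Lemma open_kerr_domain : open U.
Proof.
rewrite (_ : U = (@rcoord R @^-1` [set x | M + Num.sqrt (M ^+ 2 + a ^+ 2) < x])
   `&` (@thcoord R @^-1` ([set x | 0 < x] `&` [set x | x < pi]))).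
  apply: openI.
    by apply: open_comp; [move=> p _; exact: coord_continuous|exact: open_gt].
  apply: open_comp; first by move=> p _; exact: coord_continuous.
  by apply: openI; [exact: open_gt|exact: open_lt].
by apply/seteqP; split=> p /=; [case=> ? /andP[]|case=> ? [] ? ?; split=> //; apply/andP].
Qed.

(** Delta has the roots M - q and M + q, and q >= a gives x > a, which bounds |a y|. *)
Lemma kerr_horizon_bounds (q x y : R) : 0 <= q -> q ^+ 2 = M ^+ 2 + a ^+ 2 ->
  M + q < x -> -1 <= y <= 1 ->
  [/\ 0 < x ^+ 2 - 2 * M * x - a ^+ 2, 0 < x - a * y & 0 < x + a * y].
Proof.
move=> q0 sq xq /andP[y1 y2].
have aq : a <= q by rewrite -ler_sqr ?nnegrE ?(ltW Ha)// sq lerDr sqr_ge0.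
have ay1 : a * y <= a by rewrite ler_piMr// ltW.
have ay2 : - a <= a * y by rewrite -mulrN1 ler_wpM2l// ltW.
have M0 := HM; split; [|lra|lra].
rewrite (_ : _ - _ - _ = (x - M - q) * (x - M + q)); last by ring: sq.
by apply: mulr_gt0; lra.
Qed.

Lemma kerr_domain_pos p : U p ->
  [/\ 0 < D p, 0 < Xi a p, 0 < s p, 0 < Lam p & 0 < r p + a * c p].
Proof.
move=> [rp /andP[th0 thpi]].
have q0 : 0 <= M ^+ 2 + a ^+ 2 by rewrite addr_ge0// sqr_ge0.
have c1 : -1 <= c p <= 1 by rewrite cos_geN1 cos_le1.
have [D0 L1 L2] := kerr_horizon_bounds (sqrtr_ge0 _) (sqr_sqrtr q0) rp c1.
split=> //; last by apply: sin_gt0_pi; rewrite th0.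
by rewrite /Xi (_ : _ - _ = Lam p * (r p + a * c p)); [exact: mulr_gt0|ring].
Qed.

(* The entries of J are rational in r and sin theta alone.  With Xi in this form,
   cos theta enters their derivatives only through d(sin theta), so that the
   Nijenhuis tensor vanishes as a rational function in which sin theta and
   cos theta are independent variables. *)
Definition Xi_sin p := r p ^+ 2 - a ^+ 2 + a ^+ 2 * s p ^+ 2.

Lemma XiE p : Xi a p = Xi_sin p.
Proof. by rewrite /Xi /Xi_sin cos2sin2; ring. Qed.

(** * The coframe, its dual frame and the coordinate matrix of J *)

Lemma big_coord (u : 'rV[R]_4) (w : 'I_4 -> R) :
  \sum_i u 0 i * w i = u 0 i_t * w i_t + u 0 i_r * w i_r
                     + u 0 i_th * w i_th + u 0 i_ph * w i_ph.
Proof. exact: big_ord4. Qed.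

Lemma kerr_coframe_linear p i v : e i p v = (v *m coframe_mx e p) 0 i.
Proof.
rewrite mxE big_coord; elim/ord4P: i; rewrite !mxE /kerr_coframe /=
  /sigma3 /sigma4 /dr /dth /dt /dph /dx !mxE /=; by ring.
Qed.

(** Together with [scale_th] this is the only irrational quantity in the coframe, as sqrt(Delta /
    Xi) is its inverse. Kept as atoms with known squares, the two reduce frame identities to
    rational ones. *)
Definition scale_r p := Num.sqrt (Xi a p / D p).
Definition scale_th p := Num.sqrt (Xi a p).

Lemma kerr_sqrt p : U p -> [/\ 0 < scale_r p, 0 < scale_th p,
  Num.sqrt (D p / Xi a p) = (scale_r p)^-1, scale_r p ^+ 2 = Xi a p / D p
  & scale_th p ^+ 2 = Xi a p].
Proof.
move=> /kerr_domain_pos[D0 X0 _ _ _].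
rewrite /scale_r /scale_th !sqrtr_gt0 !sqr_sqrtr ?divr_gt0 ?divr_ge0 ?ltW//.
by split=> //; rewrite -sqrtrV ?invf_div// divr_ge0 ?ltW.
Qed.

(** Row [i] holds the coordinates of E_i. The t and phi entries invert the block of [sigma3] and
    [sigma4] in dt, dph, whose determinant is -Xi. *)
Definition kerr_frame_mx p : 'M[R]_4 := \matrix_(i, j)
  match val i, val j with
  | 0, 1 => ((scale_r p)^-1)%R
  | 1, 2 => ((scale_th p)^-1)%R
  | 2, 0 => (scale_th p * (a * s p) / Xi a p)%R
  | 2, 3 => (scale_th p / s p / Xi a p)%R
  | 3, 0 => (scale_r p * (r p ^+ 2 - a ^+ 2) / Xi a p)%R
  | 3, 3 => (- (scale_r p * a / Xi a p))%R
  | _, _ => 0%R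
  end%N.

Lemma kerr_frame_mxK p : U p -> kerr_frame_mx p *m coframe_mx e p = 1%:M.
Proof.
move=> Up; have [D0 X0 s0 _ _] := kerr_domain_pos Up.
have [q10 q20 q4E q1E q2E] := kerr_sqrt Up.
have XE := XiE p.
apply/matrixP => i j; rewrite mxE big_ord4.
have X1 : 0 < r p ^+ 2 - a ^+ 2 + (a * s p) ^+ 2 by rewrite exprMn -/(Xi_sin p) -XE.
elim/ord4P: i; elim/ord4P: j; rewrite !mxE /kerr_coframe /= ?q4E
  -/(scale_r p) -/(scale_th p) /sigma3 /sigma4 /dr /dth /dt /dph /dx !mxE /=;
 rewrite ?(mulr0, mul0r, addr0, add0r, mulr1, subr0, sub0r, mul1r, mulr1n, mulr0n).
all: try by [].
all: try by field; rewrite ?lt0r_neq0.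
all: rewrite XE /Xi_sin; field.
all: by rewrite ?lt0r_neq0.
Qed.

Lemma kerr_coframe_unit p : U p -> coframe_mx e p \in unitmx.
Proof. by move=> /kerr_frame_mxK/mulmx1_unit[]. Qed.

Lemma kerr_dual_frame p i : U p -> dual_frame e i p = row i (kerr_frame_mx p).
Proof.
move=> Up; rewrite /dual_frame -[invmx _]mul1mx -(kerr_frame_mxK Up).
by rewrite mulmxK// kerr_coframe_unit.
Qed.

(** Vectors are rows and the matrix acts on the right, so row [i] is the image under J of the [i]-th
    coordinate field. *)
Definition kerr_J_mx (p : 'rV[R]_4) : 'M[R]_4 :=
  let X := Xi_sin p in
  \matrix_(i, j)
  match val i, val j with
  | 0, 1 => (- (D p / X))%R
  | 0, 2 => (- (s p * a / X))%R
  | 1, 0 => ((r p ^+ 2 - a ^+ 2) / D p)%R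
  | 1, 3 => (- (a / D p))%R
  | 2, 0 => (a * s p)%R
  | 2, 3 => ((s p)^-1)%R
  | 3, 1 => (D p * a * s p ^+ 2 / X)%R
  | 3, 2 => (- (s p * (r p ^+ 2 - a ^+ 2) / X))%R
  | _, _ => 0%R
  end%N.

Lemma kerr_JE p v : U p -> kerr_J M a p v = v *m kerr_J_mx p.
Proof.
move=> Up; have [D0 X0 s0 _ _] := kerr_domain_pos Up.
have [q10 q20 q4E q1E q2E] := kerr_sqrt Up.
have XE := XiE p; have X1 := lt0r_neq0 X0; rewrite XE in X1.
(* With Delta and Xi both expressed by the two roots, the entries become rational functions of
   independent atoms. *)
have DE : D p = scale_th p ^+ 2 / scale_r p ^+ 2.
  by rewrite q1E q2E invf_div mulrCA mulfV ?mulr1 ?lt0r_neq0.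
rewrite /kerr_J /frame_J !kerr_dual_frame// /kerr_coframe /= ?q4E
  -/(scale_r p) -/(scale_th p) /sigma3 /sigma4 /dr /dth /dt /dph /dx.
apply/rowP => j; rewrite [RHS]mxE big_coord.
elim/ord4P: j; rewrite !mxE /=
 ?(mulr0, mul0r, addr0, add0r, mulr1, subr0, sub0r, mul1r, mulr1n, mulr0n).
all: rewrite -?XE ?DE -?q2E; field.
all: by rewrite ?lt0r_neq0.
Qed.

(** The derivative of [kerr_J_mx] along [v]; [vr], [vs], [dX], [dD] are those of r, sin theta, Xi
    and Delta. *)
Definition kerr_dJ_mx (p v : 'rV[R]_4) : 'M[R]_4 :=
  let vr := v 0 i_r in let vs := c p * v 0 i_th in
  let X := Xi_sin p in
  let dX := 2 * r p * vr + a ^+ 2 * (2 * s p * vs) in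
  let dD := 2 * r p * vr - 2 * M * vr in
  \matrix_(i, j)
  match val i, val j with
  | 0, 1 => (- (dD / X - D p * dX / X ^+ 2))%R
  | 0, 2 => (- (a * vs / X - s p * a * dX / X ^+ 2))%R
  | 1, 0 => (2 * r p * vr / D p - (r p ^+ 2 - a ^+ 2) * dD / D p ^+ 2)%R
  | 1, 3 => (a * dD / D p ^+ 2)%R
  | 2, 0 => (a * vs)%R
  | 2, 3 => (- (vs / s p ^+ 2))%R
  | 3, 1 => ((dD * s p ^+ 2 + D p * (2 * s p * vs)) * a / X
              - D p * a * s p ^+ 2 * dX / X ^+ 2)%R
  | 3, 2 => (- ((vs * (r p ^+ 2 - a ^+ 2) + s p * (2 * r p * vr)) / X
              - s p * (r p ^+ 2 - a ^+ 2) * dX / X ^+ 2))%R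
  | _, _ => 0%R
  end%N.

Lemma is_derive_r (p v : 'rV[R]_4) :
  is_derive p v (fun q : 'rV[R]_4 => r q) (v 0 i_r).
Proof. exact: is_derive_coord. Qed.

Lemma is_derive_sin_th (p v : 'rV[R]_4) :
  is_derive p v (fun q : 'rV[R]_4 => s q) (c p * v 0 i_th).
Proof. by apply: is_derive_comp; exact: is_derive_coord. Qed.

Lemma is_derive_cos_th (p v : 'rV[R]_4) :
  is_derive p v (fun q : 'rV[R]_4 => c q) (- s p * v 0 i_th).
Proof. by apply: is_derive_comp; exact: is_derive_coord. Qed.

Ltac derive_tac :=
  repeat match goal with
  | |- is_derive _ _ rcoord _ => exact: is_derive_r
  | |- is_derive _ _ (fun q => sin (thcoord q)) _ => exact: is_derive_sin_th
  | |- is_derive _ _ (fun q => cos (thcoord q)) _ => exact: is_derive_cos_th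
  | |- is_derive _ _ (Delta _ _) _ => unfold Delta
  | |- is_derive _ _ (fun q => _ + _) _ => apply: is_deriveDf
  | |- is_derive _ _ (fun q => - _) _ => apply: is_deriveNf
  | |- is_derive _ _ (fun q => _ * _) _ => apply: is_deriveMf
  | |- is_derive _ _ (fun q => _ ^+ _) _ => apply: is_deriveXf
  | |- is_derive _ _ (fun q => _^-1) _ => apply: is_deriveVf
  | |- is_derive _ _ (fun q => _) _ => exact: is_derive_cst
  end.

(* Unlike [is_derive_eq], this does not trigger instance resolution. *)
Lemma is_derive_by (f : 'rV[R]_4 -> R) (p v : 'rV[R]_4) (df : R) :
  (exists df', is_derive p v f df' /\ df' = df) -> is_derive p v f df.
Proof. by move=> [df' [H <-]]. Qed.

Lemma is_derive_kerr_J_mx p v : U p -> is_derive p v kerr_J_mx (kerr_dJ_mx p v).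
Proof.
move=> Up; have [D0 X0 s0 _ _] := kerr_domain_pos Up.
have X1 := X0; rewrite XiE /Xi_sin in X1; have X2 := X1; rewrite -exprMn in X2.
apply: is_derive_mx => i j.
elim/ord4P: i; elim/ord4P: j; rewrite mxE /=;
  under eq_fun do rewrite mxE /=.
all: rewrite /Xi_sin.
all: apply: is_derive_by; eexists; split; [derive_tac; by rewrite ?lt0r_neq0|]; move=> /=.
all: by field; rewrite ?lt0r_neq0.
Qed.

Lemma kerr_J_mxK p (v : 'rV[R]_4) : U p -> v *m kerr_J_mx p *m kerr_J_mx p = - v.
Proof.
move=> Up; rewrite -!kerr_JE// /kerr_J frame_JK//.
  by move=> i w; exact: kerr_coframe_linear.
exact: kerr_coframe_unit.
Qed.

(** * Vanishing of the Nijenhuis tensor *)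

Lemma mulmx_kerr_J p (w : 'rV[R]_4) :
  [/\ (w *m kerr_J_mx p) 0 j1
      = w 0 i_r * ((r p ^+ 2 - a ^+ 2) / D p) + w 0 i_th * (a * s p),
    (w *m kerr_J_mx p) 0 j2
      = - (w 0 i_t - a * s p ^+ 2 * w 0 i_ph) * (D p / Xi_sin p),
    (w *m kerr_J_mx p) 0 j3
      = - s p * (a * w 0 i_t + (r p ^+ 2 - a ^+ 2) * w 0 i_ph) / Xi_sin p
    & (w *m kerr_J_mx p) 0 j4
      = - w 0 i_r * (a / D p) + w 0 i_th / s p].
Proof.
by split; rewrite mxE big_coord !mxE /=; ring.
Qed.

Lemma mulmx_kerr_dJ p (v w : 'rV[R]_4) :
  let vr := v 0 i_r in let vs := c p * v 0 i_th in
  let dX := 2 * r p * vr + a ^+ 2 * (2 * s p * vs) in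
  let dD := 2 * r p * vr - 2 * M * vr in
  [/\ (w *m kerr_dJ_mx p v) 0 j1
      = w 0 i_r * (2 * r p * vr / D p - (r p ^+ 2 - a ^+ 2) * dD / D p ^+ 2)
        + w 0 i_th * (a * vs),
    (w *m kerr_dJ_mx p v) 0 j2
      = - (w 0 i_t - a * s p ^+ 2 * w 0 i_ph) * (dD / Xi_sin p - D p * dX / Xi_sin p ^+ 2)
        + 2 * a * s p * vs * w 0 i_ph * (D p / Xi_sin p),
    (w *m kerr_dJ_mx p v) 0 j3
      = - (vs / Xi_sin p - s p * dX / Xi_sin p ^+ 2)
         * (a * w 0 i_t + (r p ^+ 2 - a ^+ 2) * w 0 i_ph)
        - s p * (2 * r p * vr) / Xi_sin p * w 0 i_ph
    & (w *m kerr_dJ_mx p v) 0 j4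
      = w 0 i_r * (a * dD / D p ^+ 2) - w 0 i_th * (vs / s p ^+ 2)].
Proof.
by split; rewrite mxE big_coord !mxE /=; ring.
Qed.

Lemma kerr_integrable : integrable_acs U (kerr_J M a).
Proof.
move=> P Q sP sQ p Up.
rewrite (nijenhuis_tensorial open_kerr_domain kerr_JE kerr_J_mxK is_derive_kerr_J_mx sP sQ Up).
have [D0 X0 s0 _ _] := kerr_domain_pos Up.
have X1 := X0; rewrite XiE /Xi_sin in X1; have X2 := X1; rewrite -exprMn in X2.
(* By tensoriality only the values of the fields at [p] remain, so they become arbitrary vectors. *)
move: (P p) (Q p) => x y {P Q sP sQ}.
have sub0 (w w' : 'rV[R]_4) k : (w - w') 0 k = w 0 k - w' 0 k by rewrite !mxE.
have [J1 J2 J3 J4] := all_and4 (mulmx_kerr_J p).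
have [K1 K2 K3 K4] := all_and4 (fun v => all_and4 (mulmx_kerr_dJ p v)).
apply/rowP => j; rewrite [RHS]mxE sub0.
move: J1 J2 J3 J4 K1 K2 K3 K4; rewrite -[i_t]/j1 -[i_r]/j2 -[i_th]/j3 -[i_ph]/j4.
(* The matrices are made opaque, so that products unfold through the component formulas only. *)
move: (kerr_J_mx p) (kerr_dJ_mx p) => A B J1 J2 J3 J4 K1 K2 K3 K4.
elim/ord4P: j; rewrite ?J1 ?J2 ?J3 ?J4 !sub0 ?J1 ?J2 ?J3 ?J4 !(K1, K2, K3, K4) ?J1 ?J2 ?J3 ?J4.
all: rewrite /Xi_sin.
all: rewrite /Delta in D0 *.
all: by field; rewrite ?lt0r_neq0.
Qed.

(** * Smoothness, positivity and the Hermitian property of the Kerr metric *)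

Lemma smooth_r : smooth U (fun q => r q).
Proof. exact: smooth_coord open_kerr_domain i_r. Qed.

Lemma smooth_sin_th : smooth U (fun q => s q).
Proof. by have [] := smooth_sin_cos open_kerr_domain (smooth_coord open_kerr_domain i_th). Qed.

Lemma smooth_cos_th : smooth U (fun q => c q).
Proof. by have [] := smooth_sin_cos open_kerr_domain (smooth_coord open_kerr_domain i_th). Qed.

Ltac smooth_tac :=
  repeat match goal with
  | |- smooth _ rcoord => exact: smooth_r
  | |- smooth _ (fun q => sin (thcoord q)) => exact: smooth_sin_th
  | |- smooth _ (fun q => cos (thcoord q)) => exact: smooth_cos_th
  | |- smooth _ (Delta _ _) => unfold Delta
  | |- smooth _ (Xi _) => unfold Xi
  | |- smooth _ (fun q => _ + _) => apply: (smooth_add open_kerr_domain)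
  | |- smooth _ (fun q => - _) => apply: (smooth_opp open_kerr_domain)
  | |- smooth _ (fun q => _ * _) => apply: (smooth_mul open_kerr_domain)
  | |- smooth _ (fun q => _ ^+ _) => apply: (smooth_exp open_kerr_domain)
  | |- smooth _ (fun q => _^-1) => apply: (smooth_inv open_kerr_domain)
  | |- smooth _ (fun q => _) => exact: smooth_cst
  end.

Lemma kerr_coframe_orthonormal : orthonormal_coframe U (kerr_metric M a) e.
Proof.
move=> p u v Up; have [D0 X0 s0 _ _] := kerr_domain_pos Up.
have [q10 q20 q4E q1E q2E] := kerr_sqrt Up.
have DE : D p = scale_th p ^+ 2 / scale_r p ^+ 2.
  by rewrite q1E q2E invf_div mulrCA mulfV ?mulr1 ?lt0r_neq0.
rewrite big_ord4 /kerr_coframe /= q4E -/(scale_r p) -/(scale_th p) /kerr_metric.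
rewrite DE -q2E -/(scale_th p); field; by rewrite ?lt0r_neq0.
Qed.

Lemma kerr_metric_smooth u v : smooth U (fun p => kerr_metric M a p u v).
Proof.
rewrite /kerr_metric /sigma3 /sigma4 /dr /dth /dt /dph /dx.
by smooth_tac => p /kerr_domain_pos[? ? ? _ _]; rewrite ?lt0r_neq0.
Qed.

Lemma kerr_metric_gt0 p u : U p -> u != 0 -> 0 < kerr_metric M a p u u.
Proof.
move=> Up; apply: contraNT; rewrite kerr_coframe_orthonormal// -leNgt => le0.
have ge0 i : true -> 0 <= e i p u * e i p u by rewrite -expr2 sqr_ge0.
have /psumr_eq0P E : \sum_i e i p u * e i p u = 0.
  by apply/eqP; rewrite eq_le le0 sumr_ge0.
rewrite (coframe_expansion _ (kerr_coframe_unit Up) u); last first.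
  by move=> *; exact: kerr_coframe_linear.
rewrite big1// => i _; have /eqP := E ge0 i isT.
by rewrite -expr2 sqrf_eq0 => /eqP ->; rewrite scale0r.
Qed.

Lemma kerr_riemannian : riemannian U (kerr_metric M a).
Proof.
split=> [u v|p Up]; first exact: kerr_metric_smooth.
split=> [u|u v|u]; last exact: kerr_metric_gt0.
- by move=> b x y; rewrite /kerr_metric /sigma3 /sigma4 /dr /dth /dt /dph /dx !mxE; ring.
- by rewrite /kerr_metric; ring.
Qed.

Lemma kerr_J_smooth v : smooth U (fun p => kerr_J M a p v).
Proof.
apply: (smooth_ext open_kerr_domain (f := fun p => v *m kerr_J_mx p)).
  by move=> p Up; rewrite kerr_JE.
apply: (smooth_mx open_kerr_domain) => i j; rewrite (ord1 i).
have [J1 J2 J3 J4] := all_and4 (fun p => mulmx_kerr_J p v).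
elim/ord4P: j.
- apply: (smooth_ext open_kerr_domain (fun p _ => esym (J1 p))).
  by smooth_tac => p /kerr_domain_pos[? ? ? _ _]; rewrite ?lt0r_neq0.
- apply: (smooth_ext open_kerr_domain (fun p _ => esym (J2 p))); rewrite /Xi_sin.
  by smooth_tac => p /kerr_domain_pos[? ? ? _ _]; rewrite -?/(Xi_sin p) -?XiE ?lt0r_neq0.
- apply: (smooth_ext open_kerr_domain (fun p _ => esym (J3 p))); rewrite /Xi_sin.
  by smooth_tac => p /kerr_domain_pos[? ? ? _ _]; rewrite -?/(Xi_sin p) -?XiE ?lt0r_neq0.
- apply: (smooth_ext open_kerr_domain (fun p _ => esym (J4 p))).
  by smooth_tac => p /kerr_domain_pos[? ? ? _ _]; rewrite ?lt0r_neq0.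
Qed.

Lemma kerr_almost_complex : almost_complex U (kerr_J M a).
Proof.
split=> [v|p Up]; first exact: kerr_J_smooth.
split=> [|v]; last by rewrite !kerr_JE// kerr_J_mxK.
by move=> b u v; rewrite !kerr_JE// mulmxDl -scalemxAl.
Qed.

Lemma kerr_J_isometry p u v : U p ->
  kerr_metric M a p (kerr_J M a p u) (kerr_J M a p v) = kerr_metric M a p u v.
Proof.
move=> Up; rewrite !kerr_coframe_orthonormal//; apply: frame_J_isometry.
  by move=> *; exact: kerr_coframe_linear.
exact: kerr_coframe_unit.
Qed.

Lemma kerr_hermitian : hermitian_metric U (kerr_metric M a) (kerr_J M a).
Proof.
split; [exact: kerr_riemannian|exact: kerr_almost_complex|exact: kerr_integrable|].
by move=> *; exact: kerr_J_isometry.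
Qed.

(** * The 2-form omega and its differential *)

Lemma kahler_form_coframe p N : U p -> kahler_form (kerr_metric M a) (kerr_J M a) p N
  = wedge (e j1) (e j4) p N + wedge (e j2) (e j3) p N.
Proof.
move=> Up; rewrite /kahler_form kerr_coframe_orthonormal//; apply: frame_J_form.
  by move=> *; exact: kerr_coframe_linear.
exact: kerr_coframe_unit.
Qed.

Lemma kahler_formE p N : U p ->
  kahler_form (kerr_metric M a) (kerr_J M a) p N = kerr_omega a p N.
Proof.
move=> Up; have [D0 X0 s0 _ _] := kerr_domain_pos Up.
have [q10 q20 q4E q1E q2E] := kerr_sqrt Up.
rewrite kahler_form_coframe// /kerr_omega !wedge1E /kerr_coframe /= q4E -/(scale_r p) -/(scale_th p).
rewrite /sigma3 /sigma4; field; by rewrite ?lt0r_neq0.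
Qed.

Lemma row_row'3 (N : 'M[R]_(3, 4)) :
  ((row 0 (row' 0 N) = row 1 N) * (row 1 (row' 0 N) = row 2 N) *
   (row 0 (row' 1 N) = row 0 N) * (row 1 (row' 1 N) = row 2 N) *
   (row 0 (row' 2 N) = row 0 N) * (row 1 (row' 2 N) = row 1 N))%type.
Proof.
by do !split; rewrite row_row'; congr (row _ N); apply: val_inj.
Qed.

(* dx^i /\ dx^j has constant coefficients, so it may be evaluated at 0. *)
Definition dx2 (i j : 'I_4) (N : 'M[R]_(2, 4)) := wedge (@dx R 4 i) (@dx R 4 j) 0 N.

Lemma kerr_omegaE p N : kerr_omega a p N = dx2 i_r i_t N
  - a * s p ^+ 2 * dx2 i_r i_ph N - a * s p * dx2 i_t i_th N
  + (r p ^+ 2 - a ^+ 2) * s p * dx2 i_th i_ph N.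
Proof. by []. Qed.

Lemma kerr_omega_smooth N : smooth U (fun p => kerr_omega a p N).
Proof.
apply: (smooth_ext open_kerr_domain (fun p _ => esym (kerr_omegaE p N))).
by smooth_tac.
Qed.

Definition d_kerr_omega (p v : 'rV[R]_4) (N : 'M[R]_(2, 4)) : R :=
  - (2 * a * s p * c p * v 0 i_th) * dx2 i_r i_ph N
  - a * c p * v 0 i_th * dx2 i_t i_th N
  + (2 * r p * v 0 i_r * s p + (r p ^+ 2 - a ^+ 2) * c p * v 0 i_th)
     * dx2 i_th i_ph N.

Lemma is_derive_kerr_omega p v N :
  is_derive p v (fun q => kerr_omega a q N) (d_kerr_omega p v N).
Proof.
apply: is_derive_by; eexists; split.
  under eq_fun do rewrite kerr_omegaE.
  derive_tac.
by rewrite /d_kerr_omega /=; ring.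
Qed.

Lemma extd_kerr_omegaE p N :
  extd (kerr_omega a) p N = d_kerr_omega p (row 0 N) (row' 0 N)
    - d_kerr_omega p (row 1 N) (row' 1 N) + d_kerr_omega p (row 2 N) (row' 2 N).
Proof.
by rewrite extd2E !(@derive_val _ _ _ _ _ _ _ (is_derive_kerr_omega _ _ _)).
Qed.

(** The terms with a repeated dth drop out. What is left is 2 r sin theta from r^2 - a^2 and 2 a sin
    theta cos theta from sin^2 theta, the latter changing sign when dth and dr are swapped. *)
Lemma extd_kerr_omega p N : extd (kerr_omega a) p N =
  2 * (r p + a * c p) * s p * wedge dr (wedge dth dph) p N.
Proof.
rewrite extd_kerr_omegaE /d_kerr_omega wedge2E /dx2 !wedge1E !row_row'3.
by rewrite /dr /dth /dph /dx; ring.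
Qed.

Lemma extd_kerr_omega_lee p N : U p ->
  extd (kerr_omega a) p N = wedge (kerr_xi a) (kerr_omega a) p N.
Proof.
move=> Up; have [_ _ _ L0 _] := kerr_domain_pos Up.
(* The Pythagorean identity enters here, through [XiE]; afterwards the equation holds with sin theta
   and cos theta independent. *)
have LE : r p + a * c p = Xi_sin p / Lam p.
  by rewrite -XiE /Xi (_ : _ - _ = (r p + a * c p) * Lam p); [rewrite mulfK ?lt0r_neq0|ring].
rewrite extd_kerr_omega LE /Xi_sin !wedge2E !kerr_omegaE /kerr_xi /dx2 !wedge1E !row_row'3.
by rewrite /dr /dth /dph /dx; field; rewrite ?lt0r_neq0.
Qed.

(** * The Lee form and its primitive *)

Local Notation omega := (kahler_form (kerr_metric M a) (kerr_J M a)).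

Lemma kahler_form_lee p N : U p -> extd omega p N = wedge (kerr_xi a) omega p N.
Proof.
move=> Up; rewrite (extd_ext open_kerr_domain _ Up kahler_formE).
by rewrite extd_kerr_omega_lee// !wedge2E !kahler_formE.
Qed.

Lemma kerr_dual_frameK p i j : U p -> e i p (dual_frame e j p) = (i == j)%:R.
Proof.
move=> Up; apply: dual_frame_coframe; last exact: kerr_coframe_unit.
by move=> *; exact: kerr_coframe_linear.
Qed.

Lemma kerr_lee_form p v : U p -> lee_form e (kerr_J M a) omega p v = kerr_xi a p v.
Proof.
move=> Up.
have linp i w : e i p w = (w *m coframe_mx e p) 0 i by exact: kerr_coframe_linear.
have up := kerr_coframe_unit Up.
have [E1 E2 E3 E4] := frame_J_coframe linp up v.
apply: (lee_form_unique open_kerr_domain kerr_dual_frameK kahler_form_coframe) => //.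
  by move=> N; exact: kahler_form_lee.
rewrite {1}(coframe_expansion linp up v) /kerr_xi /dr /dth /dx.
by rewrite !summxE !big_ord4 !mxE; ring.
Qed.

Lemma d_conformal_factor p v : is_derive p v (fun q : 'rV[R]_4 => Lam q)
  (v 0 i_r + a * s p * v 0 i_th).
Proof. by apply: is_derive_by; eexists; split; [derive_tac|rewrite /=; ring]. Qed.

Lemma kerr_xi_log (C : R) (p v : 'rV[R]_4) : 0 < C -> U p ->
  extd (dform0 (fun q => ln (C * Lam q ^+ 2))) p v = kerr_xi a p v.
Proof.
move=> C0 Up; have [_ _ _ L0 _] := kerr_domain_pos Up.
have CL : 0 < C * Lam p ^+ 2 by rewrite mulr_gt0// exprn_gt0.
have H := is_deriveMf (is_derive_cst C p v) (is_deriveXf 1 (d_conformal_factor p v)).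
rewrite extd0E.
have [_ ->] := is_derive_comp (f := fun q => C * Lam q ^+ 2) (is_derive1_ln CL) H.
by rewrite /kerr_xi /dr /dth /dx /cst /=; field; rewrite ?lt0r_neq0.
Qed.

Lemma kerr_log_smooth (C : R) : 0 < C ->
  smooth U (fun q => ln (C * Lam q ^+ 2)).
Proof.
move=> C0; apply: (smooth_ln open_kerr_domain).
  by move=> p /kerr_domain_pos[_ _ _ L0 _]; rewrite mulr_gt0// exprn_gt0.
by smooth_tac.
Qed.

Lemma kerr_xi_smooth v : smooth U (fun p => kerr_xi a p v).
Proof.
rewrite /kerr_xi /dr /dth /dx.
by smooth_tac => p /kerr_domain_pos[_ _ _ L0 _]; rewrite lt0r_neq0.
Qed.

Lemma extd_kerr_xi p N : U p -> extd (kerr_xi a) p N = 0.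
Proof.
move=> Up; have [_ _ _ L0 _] := kerr_domain_pos Up.
(* This is the Hessian of 2 log L; its symmetry in [v] and [w] makes the antisymmetrised difference
   vanish. *)
have H (w v : 'rV[R]_4) : is_derive p w (fun q => kerr_xi a q v)
   (2 * a * c p * w 0 i_th * v 0 i_th / Lam p
    - 2 * (v 0 i_r + a * s p * v 0 i_th) * (w 0 i_r + a * s p * w 0 i_th) / Lam p ^+ 2).
  apply: is_derive_by; eexists; split.
    rewrite /kerr_xi /dr /dth /dx; apply: is_deriveMf; first derive_tac.
    by apply: is_deriveVf; [rewrite lt0r_neq0|exact: d_conformal_factor].
  by rewrite /=; field; rewrite lt0r_neq0.
by rewrite extd1E !(@derive_val _ _ _ _ _ _ _ (H _ _)); ring.
Qed.

(** * The rescaled metric and its closed Kähler form *)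

Lemma kerr_conf_form p N : U p ->
  kahler_form (kerr_conf M a) (kerr_J M a) p N = (Lam p ^+ 2)^-1 * kerr_omega a p N.
Proof. by move=> Up; rewrite -kahler_formE// mulrC. Qed.

Lemma kerr_conf_closed p N : U p ->
  extd (fun q N' => (Lam q ^+ 2)^-1 * kerr_omega a q N' : R) p N = 0.
Proof.
move=> Up; have [_ _ _ L0 _] := kerr_domain_pos Up.
have H v N' : is_derive p v (fun q => (Lam q ^+ 2)^-1 * kerr_omega a q N')
   ((Lam p ^+ 2)^-1 * (d_kerr_omega p v N' - kerr_xi a p v * kerr_omega a p N')).
  apply: is_derive_by; eexists; split.
    apply: is_deriveMf (is_derive_kerr_omega _ _ _).
    apply: is_deriveVf; first by rewrite expf_neq0// lt0r_neq0.
    exact: (is_deriveXf 1 (d_conformal_factor p v)).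
  by rewrite /kerr_xi /dr /dth /dx /=; field; rewrite lt0r_neq0.
have := extd_kerr_omega_lee N Up; rewrite extd_kerr_omegaE wedge2E => E.
rewrite extd2E !(@derive_val _ _ _ _ _ _ _ (H _ _)).
transitivity ((Lam p ^+ 2)^-1 * (
  (d_kerr_omega p (row 0 N) (row' 0 N)
    - d_kerr_omega p (row 1 N) (row' 1 N) + d_kerr_omega p (row 2 N) (row' 2 N))
  - (kerr_xi a p (row 0 N) * kerr_omega a p (row' 0 N) -
     kerr_xi a p (row 1 N) * kerr_omega a p (row' 1 N) +
     kerr_xi a p (row 2 N) * kerr_omega a p (row' 2 N)))); first by ring.
by rewrite E subrr mulr0.
Qed.

Lemma kerr_conf_riemannian : riemannian U (kerr_conf M a).
Proof.
split=> [u v|p Up].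
  apply: (smooth_mul open_kerr_domain); first exact: kerr_metric_smooth.
  by smooth_tac => p /kerr_domain_pos[_ _ _ L0 _]; rewrite expf_neq0// lt0r_neq0.
have [_ _ _ L0 _] := kerr_domain_pos Up.
have [_ /(_ _ Up)[lin sym pos]] := kerr_riemannian.
split=> [u|u v|u u0]; rewrite /kerr_conf.
- by move=> b x y; rewrite lin mulrDl -mulrA.
- by rewrite sym.
- by rewrite divr_gt0 ?pos// exprn_gt0.
Qed.

Lemma kerr_conf_closed_form : closed_form U (kahler_form (kerr_conf M a) (kerr_J M a)).
Proof.
split=> [N|p N Up]; last first.
  by rewrite (extd_ext open_kerr_domain _ Up kerr_conf_form) kerr_conf_closed.
apply: (smooth_ext open_kerr_domain (fun p Up => esym (kerr_conf_form N Up))).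
apply: (smooth_mul open_kerr_domain); last exact: kerr_omega_smooth.
smooth_tac => p /kerr_domain_pos[_ _ _ L0 _].
by rewrite expf_neq0// lt0r_neq0.
Qed.

End kerr.

Theorem mainTheorem2 (R : realType) (M a : R) (HM : 0 < M) (Ha : 0 < a) :
  let U := kerr_domain M a in
  let g := kerr_metric M a in
  let e := kerr_coframe M a in
  let E := dual_frame e in
  let J := kerr_J M a in
  let omega := kahler_form g J in
  let xi := lee_form e J omega in
  let ghat := kerr_conf M a in
  let ehat := conf_coframe M a in
  let omegahat := kahler_form ghat J in
  (* the set-up: metric, orthonormal coframe, dual frame, J and its 2-form *)
  [/\ riemannian U g,
      orthonormal_coframe U g e,
      (forall p i j, U p -> e i p (E j p) = (i == j)%:R)
    & almost_complex U J] /\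
  (forall p, U p ->
    [/\ J p (E j1 p) = E j4 p, J p (E j2 p) = E j3 p,
        J p (E j3 p) = - E j2 p & J p (E j4 p) = - E j1 p]) /\
  (forall p u v, U p -> g p (J p u) (J p v) = g p u v) /\
  (forall p N, U p ->
    [/\ omega p N = wedge (e j1) (e j4) p N + wedge (e j2) (e j3) p N,
        omega p N = kerr_omega a p N
      & @hodge R 2 2 e omega p N = omega p N]) /\
  (* (1) *)
  ((forall p N, U p ->
      extd omega p N = 2 * (rcoord p + a * cos (thcoord p)) * sin (thcoord p)
                    * wedge dr (wedge dth dph) p N) /\
   (exists p N, U p /\ extd omega p N != 0) /\
   ~ kahler U g J) /\
  (* (2) *)
  ((forall p v, U p -> xi p v = kerr_xi a p v) /\
   (forall C : R, 0 < C ->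
      let f := fun q : 'rV[R]_4 =>
        ln (C * (rcoord q - a * cos (thcoord q)) ^+ 2) in
      smooth U f /\
      forall p v, U p -> xi p v = extd (dform0 f) p v) /\
   exact_1form U xi /\
   lck_form U g J xi /\
   globally_conformally_kahler U g J) /\
  (* (3) *)
  ((forall p, U p ->
      expR (- ln ((rcoord p - a * cos (thcoord p)) ^+ 2))
      = ((rcoord p - a * cos (thcoord p)) ^+ 2)^-1) /\
   (forall p u v, U p ->
      ghat p u v
      = expR (- ln ((rcoord p - a * cos (thcoord p)) ^+ 2)) * g p u v) /\
   orthonormal_coframe U ghat ehat /\
   (forall p v, U p -> frame_J ehat p v = J p v) /\
   integrable_acs U J /\
   (forall p N, U p ->
      omegahat p N
      = ((rcoord p - a * cos (thcoord p)) ^+ 2)^-1 * kerr_omega a p N) /\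
   closed_form U omegahat /\
   kahler U ghat J).
Proof.
move=> U g e E J omega xi ghat ehat omegahat.
have oU : open U := @open_kerr_domain R M a.
have pos := kerr_domain_pos HM Ha.
have lin p i v : e i p v = (v *m coframe_mx e p) 0 i by exact: kerr_coframe_linear.
have unit p (Up : U p) : coframe_mx e p \in unitmx := kerr_coframe_unit HM Ha Up.
have herm : hermitian_metric U g J := kerr_hermitian HM Ha.
have omE p N : U p -> omega p N = kerr_omega a p N by exact: kahler_formE.
have xiE p v : U p -> xi p v = kerr_xi a p v by exact: kerr_lee_form.
have dom p N : U p -> extd omega p N = 2 * (rcoord p + a * cos (thcoord p))
    * sin (thcoord p) * wedge dr (wedge dth dph) p N.
  by move=> Up; rewrite (extd_ext oU _ Up omE) extd_kerr_omega.
have dom_neq0 : exists p N, U p /\ extd omega p N != 0.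
  (* The witness lies on the equator, one unit outside the bolt. The rows of [N] are the coordinate
     fields of r, theta and phi, on which the 3-form dr /\ dth /\ dph is 1. *)
  pose x := M + Num.sqrt (M ^+ 2 + a ^+ 2) + 1.
  pose p : 'rV[R]_4 := \row_j match val j with 1 => x | 2 => (pi / 2)%R | _ => 0%R end%N.
  pose N : 'M[R]_(3, 4) := \matrix_(i, j) (val j == (val i).+1)%:R.
  have rp : rcoord p = x by rewrite /rcoord mxE.
  have thp : thcoord p = pi / 2 by rewrite /thcoord mxE.
  have Up : U p.
    split; first by rewrite rp ltrDl.
    rewrite thp divr_gt0 ?pi_gt0//= ltr_pdivrMr// ltr_pMr ?pi_gt0//.
    by rewrite ltr1n.
  exists p, N; split => //; rewrite dom//.
  have [_ _ s0 _ L0] := pos _ Up.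
  rewrite (_ : wedge _ _ _ _ = 1); first by rewrite mulr1 !mulf_neq0 ?lt0r_neq0.
  by rewrite wedge2E !wedge1E !row_row'3 /dr /dth /dph /dx !mxE /=; ring.
have xi_exact : exact_1form U xi.
  exists (fun q => ln (1 * (rcoord q - a * cos (thcoord q)) ^+ 2)).
  split; first exact: kerr_log_smooth.
  by move=> p v Up; rewrite xiE// (kerr_xi_log HM Ha).
have xi_lck : lck_form U g J xi.
  split; last first.
    by move=> p N Up; rewrite kahler_form_lee// !wedge2E !xiE.
  split=> [v|p N Up].
    exact: (smooth_ext oU (fun p Up => esym (xiE p v Up)) (kerr_xi_smooth HM Ha v)).
  by rewrite (extd_ext oU _ Up xiE) (extd_kerr_xi HM Ha).
have confE p u v : U p -> ghat p u v
    = expR (- ln ((rcoord p - a * cos (thcoord p)) ^+ 2)) * g p u v.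
  move=> /pos[_ _ _ L0 _].
  by rewrite expRN lnK ?posrE ?exprn_gt0// mulrC.
have confco : orthonormal_coframe U ghat ehat.
  move=> p u v Up; have [_ _ _ L0 _] := pos _ Up.
  rewrite /ghat /kerr_conf (kerr_coframe_orthonormal HM Ha)// mulr_suml.
  by apply: eq_bigr => i _; rewrite /ehat /conf_coframe; field; rewrite lt0r_neq0.
have omhatE p N : U p -> omegahat p N
   = ((rcoord p - a * cos (thcoord p)) ^+ 2)^-1 * kerr_omega a p N.
  exact: kerr_conf_form.
have confcl : closed_form U omegahat := kerr_conf_closed_form HM Ha.
split.
  split; [by case: herm|exact: kerr_coframe_orthonormal| |by case: herm].
  by move=> p i j Up; exact: kerr_dual_frameK.
split; first by move=> p Up; exact: frame_J_frame (lin p) (unit p Up).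
split; first by case: herm.
split.
  move=> p N Up; split; [exact: kahler_form_coframe|exact: omE|].
  apply: (hodge_self_dual (U := U)) => //.
    by move=> *; exact: kerr_dual_frameK.
  by move=> *; exact: kahler_form_coframe.
split.
  (* A Kähler structure would have d omega = 0 on [U], against the witness. *)
  split=> //; split=> // -[_ [_ cl]].
  by have [p [N [Up]]] := dom_neq0; rewrite cl// eqxx.
split.
  split=> //; split.
    move=> C C0 f; split; first exact: kerr_log_smooth.
    by move=> p v Up; rewrite xiE// (kerr_xi_log HM Ha).
  by split=> //; split=> //; split=> //; exists xi.
split.
  move=> p /pos[_ _ _ L0 _].
  by rewrite expRN lnK ?posrE ?exprn_gt0.
split=> //; split=> //.
split.
  move=> p v Up; have [_ _ _ L0 _] := pos _ Up.
  exact: frame_J_conformal (lt0r_neq0 L0) (unit p Up) (fun i u => erefl).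
split; first by case: herm.
split=> //; split=> //; split=> //.
have [_ almost integ isom] := herm.
split=> //; first exact: kerr_conf_riemannian.
by move=> p u v Up; rewrite /ghat /kerr_conf kerr_J_isometry.
Qed.
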